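(* Let $b\in\{N,D\}$ and let $\mu$ be a non-atomic Borel probability measure on $[0,1]$ with $0,1\in\operatorname{supp}(\mu)$. Then the restricted semigroup $(\bar T_t^b)_{t\ge0}$ is a strongly continuous contraction semigroup on the Banach space $(C[0,1])_\mu^b$.
   Context: Let $\mathcal{D}_\mu^2$ be the set of $f\in C^1([0,1])$ for which there is $(f')^\mu\in L^2([0,1],\mu)$ with $f'(x)=f'(0)+\int_0^x (f')^\mu\,d\mu$ for all $x\in[0,1]$. The Krein-Feller operators $\Delta_\mu^N$ (Neumann) and $\Delta_\mu^D$ (Dirichlet) on $L^2([0,1],\mu)$ are given by $f\mapsto(f')^\mu$ (computed from the representative in $\mathcal{D}_\mu^2$), with domains: $\mathcal{D}(\Delta_\mu^N)$ is the set of $f\in L^2([0,1],\mu)$ having a representative $\bar f\in\mathcal{D}_\mu^2$ with $\bar f'(0)=\bar f'(1)=0$; $\mathcal{D}(\Delta_\mu^D)$ is the set of $f\in L^2([0,1],\mu)$ having a representative $\bar f\in\mathcal{D}_\mu^2$ with $\bar f(0)=\bar f(1)=0$. Both are self-adjoint and non-positive; $(T_t^b)_{t\ge0}$ denotes the strongly continuous contraction semigroup on $L^2([0,1],\mu)$ generated by $\Delta_\mu^b$. $(C[0,1])_\mu^N$ is the set of elements of $L^2([0,1],\mu)$ having a continuous representative on $[0,1]$; $(C[0,1])_\mu^D$ is the set of those having a continuous representative $\bar f$ with $\bar f(0)=\bar f(1)=0$. Each is a Banach space with norm $\lVert f\rVert_\infty:=\sup_{x\in\operatorname{supp}(\mu)}|\bar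 f(x)|$, $\bar f$ a continuous representative. One has $T_t^b((C[0,1])_\mu^b)\subseteq(C[0,1])_\mu^b$, and $\bar T_t^b:(C[0,1])_\mu^b\to(C[0,1])_\mu^b$ denotes the restriction of $T_t^b$. *)

(* Defs.v *)
From HB Require Import structures.
From mathcomp Require Import all_boot all_order all_algebra.
From mathcomp Require Import all_classical all_reals all_analysis.
From mathcomp Require Import measurable_realfun.

Set Implicit Arguments.
Unset Strict Implicit.
Unset Printing Implicit Defensive.

Import Order.TTheory GRing.Theory Num.Theory.
Import numFieldNormedType.Exports.

Local Open Scope classical_set_scope.
Local Open Scope ring_scope.

(* The library's quotient LspaceType carries no algebraic structure; L^2 gets
   here the vector space structure inherited from the pointwise one. *)
Section L2_lmodule.
Context d (T : measurableType d) (R : realType).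
Variable mu : {measure set T -> \bar R}.

Local Notation L := (LspaceType mu (lee1n 2)).
Local Notation F := (LfunType mu (lee1n 2)).

HB.instance Definition _ := gen_eqMixin L.
HB.instance Definition _ := gen_choiceMixin L.

Local Open Scope quotient_scope.

Lemma measurable_L2 (u : {mfun_ mu, T >-> measurableTypeR R}) :
  measurable_fun [set: T] (u : T -> R).
Proof. exact: (@measurable_funPT _ _ _ _ (repr u)). Qed.

Lemma L2_Lfun (u : L) : (u : T -> R) \in Lfun mu 2%:R%:E.
Proof.
apply/andP; split; rewrite inE /=; last exact: Lebesgue_finite.
exact: measurable_L2.
Qed.

Definition L2_repr (u : L) : F := Lfun_Sub (lee1n 2) (L2_Lfun u).

Definition L2_mfun (f : F) : {mfun_ mu, T >-> measurableTypeR R} :=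
  \pi_({mfun_ mu, T >-> measurableTypeR R}) (mfun_Sub (mem_set (@measurable_funPT _ _ _ _ (f : {mfun T >-> R}))
    : (f : T -> measurableTypeR R) \in mfun)).

Lemma L2_mfunE (f : F) : (L2_mfun f : T -> R) = f %[ae mu].
Proof.
have : L2_mfun f
    = \pi_({mfun_ mu, T >-> measurableTypeR R}) (repr (L2_mfun f)).
  by rewrite reprK.
by move=> /eqquotP/asboolP /ae_eq_sym.
Qed.

Lemma L2_mfun_finite (f : F) : finite_norm mu 2%:R%:E (L2_mfun f).
Proof.
have mq := measurable_L2 (L2_mfun f).
have mf : measurable_fun [set: T] (f : T -> R) by exact: measurable_funPT.
have := @Lfunction_finite _ _ _ _ _ (lee1n 2) f; rewrite /finite_norm !unlock.
set I1 := (\int[_]_ _ _)%E; set I2 := (\int[_]_ _ _)%E.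
suff -> : I1 = I2 by [].
have mp (g : T -> R) : measurable_fun [set: T] g ->
    measurable_fun [set: T] (fun x => `|(g x)%:E| `^ 2%:R)%E.
  by move=> /measurable_EFinP mg; apply: (measurableT_comp (measurable_poweR _));
    exact: measurableT_comp.
apply: ae_eq_integral => //; [exact: mp|exact: mp|].
have := L2_mfunE f; apply: filterS => x /(_ Logic.I) /= fx _.
by rewrite fx.
Qed.

Definition L2_class (f : F) : L :=
  HB.pack_for L (L2_mfun f) (isFinLebesgue.Build _ _ _ _ _ _ _ (L2_mfun_finite f)).

Lemma L2_classE (f : F) : (L2_class f : T -> R) = f %[ae mu].
Proof. exact: L2_mfunE. Qed.

Lemma L2_eqP (u v : L) : (u : T -> R) = v %[ae mu] <-> u = v.
Proof.
split=> [uv|->]; last exact: ae_eq_refl.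
have : (u : {mfun_ mu, T >-> measurableTypeR R}) = v.
  rewrite -[LHS]reprK -[RHS]reprK; apply/eqmodP/asboolP.
  exact: uv.
case: u {uv} => u [[hu]]; case: v => v [[hv]] /= uv.
by subst v; rewrite (Prop_irrelevance hu hv).
Qed.

Definition L2_zero : L := L2_class 0.
Definition L2_opp (u : L) : L := L2_class (- L2_repr u).
Definition L2_add (u v : L) : L := L2_class (L2_repr u + L2_repr v).
Definition L2_scale (a : R) (u : L) : L := L2_class (a *: L2_repr u).

Lemma L2_addE (u v : L) :
  (L2_add u v : T -> R) = (fun x => u x + v x) %[ae mu].
Proof. exact: L2_classE. Qed.

Lemma L2_oppE (u : L) : (L2_opp u : T -> R) = (fun x => - u x) %[ae mu].
Proof. exact: L2_classE. Qed.

Lemma L2_scaleE a (u : L) :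
  (L2_scale a u : T -> R) = (fun x => a * u x) %[ae mu].
Proof. exact: L2_classE. Qed.

Lemma L2_zeroE : (L2_zero : T -> R) = (fun=> 0) %[ae mu].
Proof. exact: L2_classE. Qed.

Lemma ae_filterS5 (P1 P2 P3 P4 P5 Q : T -> Prop) :
  (forall x, P1 x -> P2 x -> P3 x -> P4 x -> P5 x -> Q x) ->
  {ae mu, forall x, P1 x} -> {ae mu, forall x, P2 x} ->
  {ae mu, forall x, P3 x} -> {ae mu, forall x, P4 x} ->
  {ae mu, forall x, P5 x} -> {ae mu, forall x, Q x}.
Proof.
move=> h h1 h2 h3 h4 h5.
have h12 : {ae mu, forall x, P1 x /\ P2 x} by apply: filterS2 h1 h2 => x; split.
have h34 : {ae mu, forall x, P3 x /\ P4 x} by apply: filterS2 h3 h4 => x; split.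
by apply: filterS3 h12 h34 h5 => x [? ?] [? ?] ?; exact: h.
Qed.

Lemma L2_addA : associative L2_add.
Proof.
move=> u v w; apply/L2_eqP.
have e0 : {ae mu, forall x : T, True} by exact: aeW.
move: (L2_addE u (L2_add v w)) (L2_addE v w) (L2_addE (L2_add u v) w)
  (L2_addE u v) e0.
apply: ae_filterS5 => x /(_ Logic.I) -> /(_ Logic.I) -> /(_ Logic.I) ->
  /(_ Logic.I) -> _ _.
exact: addrA.
Qed.

Lemma L2_addC : commutative L2_add.
Proof.
move=> u v; apply/L2_eqP; move: (L2_addE u v) (L2_addE v u).
apply: filterS2 => x /(_ Logic.I) -> /(_ Logic.I) -> _; exact: addrC.
Qed.

Lemma L2_add0 : left_id L2_zero L2_add.
Proof.
move=> u; apply/L2_eqP; move: (L2_addE L2_zero u) L2_zeroE.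
apply: filterS2 => x /(_ Logic.I) -> /(_ Logic.I) -> _; exact: add0r.
Qed.

Lemma L2_addN : left_inverse L2_zero L2_opp L2_add.
Proof.
move=> u; apply/L2_eqP.
move: (L2_addE (L2_opp u) u) (L2_oppE u) L2_zeroE.
apply: filterS3 => x /(_ Logic.I) -> /(_ Logic.I) -> /(_ Logic.I) -> _.
exact: addNr.
Qed.

HB.instance Definition _ :=
  GRing.isZmodule.Build L L2_addA L2_addC L2_add0 L2_addN.

Lemma L2_scaleA a b (u : L) : L2_scale a (L2_scale b u) = L2_scale (a * b) u.
Proof.
apply/L2_eqP.
move: (L2_scaleE a (L2_scale b u)) (L2_scaleE b u) (L2_scaleE (a * b) u).
apply: filterS3 => x /(_ Logic.I) -> /(_ Logic.I) -> /(_ Logic.I) -> _.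
exact: mulrA.
Qed.

Lemma L2_scale1 : left_id 1 L2_scale.
Proof.
move=> u; apply/L2_eqP; move: (L2_scaleE 1 u).
apply: filterS => x /(_ Logic.I) -> _; exact: mul1r.
Qed.

Lemma L2_scaleDr : right_distributive L2_scale L2_add.
Proof.
move=> a u v; apply/L2_eqP.
move: (L2_scaleE a (L2_add u v)) (L2_addE u v)
  (L2_addE (L2_scale a u) (L2_scale a v)) (L2_scaleE a u) (L2_scaleE a v).
apply: ae_filterS5 => x /(_ Logic.I) -> /(_ Logic.I) -> /(_ Logic.I) ->
  /(_ Logic.I) -> /(_ Logic.I) -> _.
exact: mulrDr.
Qed.

Lemma L2_scaleDl (u : L) :
  {morph L2_scale^~ u : a b / a + b >-> L2_add a b}.
Proof.
move=> a b; apply/L2_eqP.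
have e0 : {ae mu, forall x : T, True} by exact: aeW.
move: (L2_scaleE (a + b) u) (L2_addE (L2_scale a u) (L2_scale b u))
  (L2_scaleE a u) (L2_scaleE b u) e0.
apply: ae_filterS5 => x /(_ Logic.I) -> /(_ Logic.I) -> /(_ Logic.I) ->
  /(_ Logic.I) -> _ _.
exact: mulrDl.
Qed.

HB.instance Definition _ := GRing.Zmodule_isLmodule.Build R L
  L2_scaleA L2_scale1 L2_scaleDr L2_scaleDl.

Definition L2norm (u : LspaceType2 mu) : R := fine ('N[mu]_2%:R%:E[EFin \o u])%E.

End L2_lmodule.

Arguments L2norm {d T R} mu u.

Section semigroups.
Context (R : realType) (V : lmodType R).
Implicit Types (D : set V) (nrm : V -> R) (T : R -> V -> V).

Definition banach_subspace D nrm : Prop :=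
  [/\ D 0 /\ (forall a u v, D u -> D v -> D (a *: u + v)),
      forall u, D u -> nrm u = 0 -> u = 0,
      forall a u, D u -> nrm (a *: u) = `|a| * nrm u,
      forall u v, D u -> D v -> nrm (u + v) <= nrm u + nrm v
    & forall s : nat -> V, (forall n, D (s n)) ->
        (forall e : R, 0 < e -> exists N : nat,
          forall m n, (N <= m)%N -> (N <= n)%N -> nrm (s m - s n) < e) ->
        exists2 u, D u & (fun n => nrm (s n - u)) @ \oo --> (0 : R)].

(* T t is only meant for 0 <= t, and only its restriction to D is involved. *)
Definition C0_contraction_semigroup D nrm T : Prop :=
  [/\ forall t u, 0 <= t -> D u -> D (T t u),
      forall t a u v, 0 <= t -> D u -> D v ->
        T t (a *: u + v) = a *: T t u + T t v,
      (forall u, D u -> T 0 u = u) /\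
      (forall s t u, 0 <= s -> 0 <= t -> D u -> T (s + t) u = T s (T t u)),
      forall t u, 0 <= t -> D u -> nrm (T t u) <= nrm u
    & forall u, D u -> (fun t => nrm (T t u - u)) @ 0^'+ --> (0 : R)].

(* Graph of the infinitesimal generator. *)
Definition generator D nrm T : set (V * V) :=
  [set uv | [/\ D uv.1, D uv.2 &
    (fun t => nrm (t^-1 *: (T t uv.1 - uv.1) - uv.2)) @ 0^'+ --> (0 : R)]].

End semigroups.

Section krein_feller.
Context (R : realType).
Implicit Types (mu : probability (measurableTypeR R) R) (f g : R -> R).

Local Notation I01 := (`[0, 1]%classic : set R).

Definition atomless mu : Prop := forall x : R, mu [set x] = 0%E.

(* When mu is concentrated on [0,1], neighbourhoods in R and in [0,1] give the
   same support. *)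
Definition msupport mu : set R :=
  [set x | forall U : set R, open U -> U x -> (0 < mu U)%E].

Inductive boundary := Neumann | Dirichlet.

(* f1 is the derivative of f on [0,1], one-sided at the end points. *)
Definition derivative01 f f1 : Prop := forall x, I01 x ->
  (fun y => (f y - f x) / (y - x)) @ within I01 x^' --> f1 x.

Definition representative mu (u : LspaceType2 mu) g : Prop :=
  (u : R -> R) = g %[ae mu].

(* f is in D_mu^2, with derivative f1 and mu-derivative (f')^mu equal to h. *)
Definition D2 mu f f1 (h : LspaceType2 mu) : Prop :=
  [/\ derivative01 f f1, {within I01, continuous f1} &
      forall x, I01 x -> f1 x = f1 0 + \int[mu]_(y in `[0, x]) (h : R -> R) y].

Definition boundary_condition (b : boundary) f f1 : Prop :=
  match b with
  | Neumann => f1 0 = 0 /\ f1 1 = 0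
  | Dirichlet => f 0 = 0 /\ f 1 = 0
  end.

(* Graph of the Krein-Feller operator Delta_mu^b. *)
Definition krein_feller mu (b : boundary) :
    set (LspaceType2 mu * LspaceType2 mu) :=
  [set uh | exists f f1, [/\ representative uh.1 f, D2 f f1 uh.2
                           & boundary_condition b f f1]].

Definition continuous_representative mu (b : boundary) (u : LspaceType2 mu) :
    set (R -> R) :=
  [set g | [/\ representative u g, {within I01, continuous g} &
     match b with Neumann => True | Dirichlet => g 0 = 0 /\ g 1 = 0 end]].

Definition Cmu mu (b : boundary) : set (LspaceType2 mu) :=
  [set u | continuous_representative b u !=set0].

(* xget picks one continuous representative; any two of them agree on the
   support of mu, so the choice is immaterial. *)
Definition Cmu_norm mu (b : boundary) (u : LspaceType2 mu) : R :=
  sup [set `|xget (cst 0) (continuous_representative b u) x|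
      | x in msupport mu].

End krein_feller.

Arguments krein_feller {R} mu b.
Arguments Cmu {R} mu b.
Arguments Cmu_norm {R} mu b u.

(* Main.v *)
Require Import Defs.
From HB Require Import structures.
From mathcomp Require Import all_boot all_order all_algebra.
From mathcomp Require Import all_classical all_reals all_analysis.
From mathcomp Require Import measurable_realfun.
From mathcomp Require Import ring lra.

Set Implicit Arguments.
Unset Strict Implicit.
Unset Printing Implicit Defensive.

Import Order.TTheory GRing.Theory Num.Theory.
Import numFieldNormedType.Exports.

Local Open Scope classical_set_scope.
Local Open Scope ring_scope.

(** The resolvents and the analyticity of the semigroup are not needed: all that
    is used is the domain of the generator, which the semigroup leaves invariant.

    Write A for the Krein-Feller operator and D for its domain.  An element u of
    D has a C^1 representative f, hence lies in the space of continuous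
    functions; as f' vanishes somewhere under either boundary condition, the
    uniform norm of u is at most |u|_2 + |A u|_2 ([D2_sup_le]).  If D is dense
    for the uniform norm ([krein_feller_dense]) and the semigroup does not
    increase the uniform norm on D ([orbit_Cmu_norm_le]), then the conclusion is
    formal ([restricted_semigroup]): T_t maps D to D, and extends to
    uniform limits by completeness ([Cmu_banach]); and for u in D the uniform
    norm of T_t u - u is at most |T_t u - u|_2 + |T_t A u - A u|_2, which tends
    to 0 with t.

    The contraction property is a maximum principle.  For M >= 0 let phi(u) be
    the integral of the square of (u - M)^+, the squared L^2-distance from u to
    the functions at most M.  Integration by parts gives
      int (u - M)^+ A u dmu = - int 1_{f > M} (f')^2 dx <= 0
    ([D2_dissipative]), so that phi (T_s u) <= phi u + o(s) with a remainder
    that is uniform along the orbit of u ([excess_step],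
    [difference_quotient_orbit]); summing over n steps of length t / n shows
    that u <= M implies T_t u <= M ([orbit_ae_le]).

    For the density, the potential of a uniform density concentrated near a
    point z of the support is close to the ramp (x - z)^+ ([ramp_smoothing]).
    Combinations of ramps and constants interpolate a continuous function at
    points of the support, and approximate it on the support when consecutive
    interpolation points are either close or separated by a gap of the support
    ([node1]).  The boundary conditions are restored by a small correction. *)

(** * Restricting a contraction semigroup to a smaller Banach space *)

Section restriction.
Context {R : realType} {V : lmodType R}.
Implicit Types (D : set V) (nrm : V -> R) (T : R -> V -> V).

Lemma cvg_right0P (f : R -> R) : (forall t, 0 <= f t) ->
  f @ 0^'+ --> (0 : R) <->
  forall e : R, 0 < e -> exists2 d : R, 0 < d & forall t : R, 0 < t < d -> f t < e.
Proof.
move=> f0; split.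
- move=> /cvgrPdist_lt fc e e0.
  have := fc e e0; rewrite near_withinE => /nbhs_ballP[d /= d0 H].
  exists d => // t /andP[t0 td].
  have := H t; rewrite /ball /= sub0r normrN (gtr0_norm t0) => /(_ td t0).
  by rewrite sub0r normrN (ger0_norm (f0 t)).
- move=> H; apply/cvgrPdist_lt => e e0.
  have [d d0 Hd] := H e e0.
  rewrite near_withinE; apply/nbhs_ballP; exists d => //= t.
  rewrite /ball /= !sub0r !normrN => td t0.
  rewrite (ger0_norm (f0 t)); apply: Hd; rewrite t0 /=.
  by rewrite -(gtr0_norm t0).
Qed.

Lemma cvg_seq0P (f : nat -> R) : (forall n, 0 <= f n) ->
  f @ \oo --> (0 : R) <->
  forall e : R, 0 < e -> exists N, forall n, (N <= n)%N -> f n < e.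
Proof.
move=> f0; split.
- move=> /cvgrPdist_lt fc e e0.
  have [N _ H] := fc e e0; exists N => n Nn.
  by have := H n Nn; rewrite /= sub0r normrN (ger0_norm (f0 n)).
- move=> H; apply/cvgrPdist_lt => e e0.
  have [N HN] := H e e0; exists N => // n Nn.
  by rewrite /= sub0r normrN (ger0_norm (f0 n)); exact: HN.
Qed.

(** The norm axioms on a linear subspace, without completeness. *)
Definition norm_on D nrm : Prop :=
  [/\ D 0 /\ (forall a u v, D u -> D v -> D (a *: u + v)),
      forall u, D u -> nrm u = 0 -> u = 0,
      forall a u, D u -> nrm (a *: u) = `|a| * nrm u
    & forall u v, D u -> D v -> nrm (u + v) <= nrm u + nrm v].

Section norm_on_theory.
Context {D : set V} {nrm : V -> R}.
Hypothesis nrmP : norm_on D nrm.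

Lemma norm_on_lin a u v : D u -> D v -> D (a *: u + v).
Proof. by case: nrmP => [[_ H] _ _ _]; exact: H. Qed.

Lemma norm_on_D0 : D 0. Proof. by case: nrmP => [[]]. Qed.

Lemma norm_onZ a u : D u -> D (a *: u).
Proof. by move=> Du; rewrite -[X in D X]addr0; exact: norm_on_lin Du norm_on_D0. Qed.

Lemma norm_onB u v : D u -> D v -> D (u - v).
Proof.
by move=> Du Dv; rewrite addrC -scaleN1r; exact: norm_on_lin.
Qed.

Lemma norm_on0 : nrm 0 = 0.
Proof.
case: nrmP => [[D0 _] _ nZ _].
by rewrite -(scale0r (0 : V)) nZ// normr0 mul0r.
Qed.

Lemma norm_onN u : D u -> nrm (- u) = nrm u.
Proof.
by case: nrmP => [_ _ nZ _] Du; rewrite -scaleN1r nZ// normrN1 mul1r.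
Qed.

Lemma norm_on_tri u v : D u -> D v -> nrm (u + v) <= nrm u + nrm v.
Proof. by case: nrmP => [_ _ _]; exact. Qed.

Lemma norm_on_ge0 u : D u -> 0 <= nrm u.
Proof.
move=> Du; have := norm_on_tri Du (norm_onZ (-1) Du).
rewrite scaleN1r subrr norm_on0 norm_onN// => ?; lra.
Qed.

Lemma norm_on_triB u v w : D u -> D v -> D w ->
  nrm (u - w) <= nrm (u - v) + nrm (v - w).
Proof.
move=> Du Dv Dw.
have -> : u - w = (u - v) + (v - w) by rewrite addrA subrK.
by apply: norm_on_tri; exact: norm_onB.
Qed.

Lemma norm_on_distC u v : D u -> D v -> nrm (u - v) = nrm (v - u).
Proof. by move=> Du Dv; rewrite -opprB norm_onN//; exact: norm_onB. Qed.

End norm_on_theory.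

Lemma banach_norm_on D nrm : banach_subspace D nrm -> norm_on D nrm.
Proof. by case. Qed.

Section generator_theory.
Context {nrm : V -> R} {T : R -> V -> V}.
Hypothesis nrmP : norm_on setT nrm.
Hypothesis TP : C0_contraction_semigroup setT nrm T.

Lemma semigroupB t u v : 0 <= t -> T t (u - v) = T t u - T t v.
Proof.
move=> t0; case: TP => _ Tl _ _ _.
by rewrite addrC -scaleN1r Tl// scaleN1r addrC.
Qed.

Lemma semigroupZ t a u : 0 <= t -> T t (a *: u) = a *: T t u.
Proof.
move=> t0; case: TP => _ Tl _ _ _.
have T0 : T t 0 = 0 by have := semigroupB 0 0 t0; rewrite !subrr.
by rewrite -[in LHS](addr0 (a *: u)) Tl// T0 addr0.
Qed.

Lemma semigroup_le t u : 0 <= t -> nrm (T t u) <= nrm u.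
Proof. by move=> t0; case: TP => _ _ _ + _; exact. Qed.

Lemma semigroupD s t u : 0 <= s -> 0 <= t -> T (s + t) u = T s (T t u).
Proof. by move=> s0 t0; case: TP => _ _ [_ +] _ _; exact. Qed.

Let n0 u : 0 <= nrm u. Proof. exact: (norm_on_ge0 nrmP). Qed.

(** The error of the difference quotient of an orbit is controlled uniformly
    along the orbit by the error at its starting point. *)
Lemma difference_quotient_orbit t s u h : 0 <= t -> 0 <= s ->
  nrm (s^-1 *: (T s (T t u) - T t u) - T t h)
  <= nrm (s^-1 *: (T s u - u) - h).
Proof.
move=> t0 s0.
rewrite -(semigroupD _ s0 t0) (addrC s) (semigroupD _ t0 s0) -semigroupB// -semigroupZ// -semigroupB//.
exact: semigroup_le.
Qed.

(** The domain of the generator is invariant, and the generator commutes with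
    the semigroup. *)
Lemma generator_orbit t u h : 0 <= t ->
  generator setT nrm T (u, h) -> generator setT nrm T (T t u, T t h).
Proof.
move=> t0 [/= _ _ gen]; split => //=.
move/cvg_right0P : gen => gen; apply/cvg_right0P => [//|e e0].
have [//|d d0 H] := gen _ e e0.
exists d => // s sd; apply: le_lt_trans (H s sd).
by apply: difference_quotient_orbit => //; case/andP: sd => /ltW.
Qed.

Lemma generatorB u u' h h' : generator setT nrm T (u, h) ->
  generator setT nrm T (u', h') -> generator setT nrm T (u - u', h - h').
Proof.
move=> [/= _ _ /cvg_right0P g1] [/= _ _ /cvg_right0P g2]; split => //=.
apply/cvg_right0P => [//|e e0].
have e20 : 0 < e / 2 by rewrite divr_gt0.
have [//|d d0 H] := g1 _ _ e20; have [//|d' d'0 H'] := g2 _ _ e20.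
exists (Num.min d d'); first by rewrite lt_min d0.
move=> s /andP[s0]; rewrite lt_min => /andP[sd sd'].
rewrite semigroupB ?ltW//.
have -> : s^-1 *: (T s u - T s u' - (u - u')) - (h - h') =
  (s^-1 *: (T s u - u) - h) - (s^-1 *: (T s u' - u') - h').
  have swap (v w x y : V) : v - w - (x - y) = v - x - (w - y).
    by rewrite !opprD addrACA.
  by rewrite [in LHS]swap scalerBr swap.
apply: le_lt_trans (norm_on_tri nrmP _ _) _ => //.
rewrite (norm_onN nrmP)//.
have := H s; rewrite s0 sd => /(_ isT); have := H' s; rewrite s0 sd' => /(_ isT).
lra.
Qed.

End generator_theory.

(** A contraction semigroup restricts to a strongly continuous contraction
    semigroup on a Banach space D that embeds continuously in V as soon as the
    domain of the generator is a dense subspace of D on which the norm of D is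
    controlled by the graph norm and does not increase along orbits. *)
Lemma restricted_semigroup D (nrm nrmD : V -> R) T (C : R) :
  norm_on setT nrm -> banach_subspace D nrmD ->
  (forall u, D u -> nrm u <= nrmD u) ->
  C0_contraction_semigroup setT nrm T ->
  (forall u h, generator setT nrm T (u, h) -> D u) ->
  (forall u h, generator setT nrm T (u, h) ->
    nrmD u <= C * (nrm u + nrm h)) ->
  (forall u h (t : R), 0 <= t -> generator setT nrm T (u, h) ->
    nrmD (T t u) <= nrmD u) ->
  (forall u (e : R), D u -> 0 < e ->
    exists v h, generator setT nrm T (v, h) /\ nrmD (u - v) < e) ->
  C0_contraction_semigroup D nrmD T.
Proof.
move=> nP BD le TP GD Gn Gc Gd.
have DP := banach_norm_on BD.
have D_B := @norm_onB _ _ DP.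
have n0 u : 0 <= nrm u by exact: (norm_on_ge0 nP).
have Dapprox u : D u -> exists v : nat -> V * V,
    forall n, generator setT nrm T (v n) /\ nrmD (u - (v n).1) < n.+1%:R^-1.
  move=> Du; suff /choice[v Hv] : forall n : nat, exists v : V * V,
      generator setT nrm T v /\ nrmD (u - v.1) < n.+1%:R^-1 by exists v.
  by move=> n; have [//|v [h H]] := Gd u n.+1%:R^-1 Du; exists (v, h).
have inv_small (e : R) : 0 < e -> exists N, forall n, (N <= n)%N -> n.+1%:R^-1 < e :> R.
  move=> e0; have /cvg_seq0P H : (fun n => n.+1%:R^-1) @ \oo --> (0 : R).
    exact: cvg_harmonic.
  by apply: H => // n; rewrite invr_ge0.
have inv_tri (t : R) u : 0 <= t -> D u -> D (T t u) /\ nrmD (T t u) <= nrmD u.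
  move=> t0 Du; have [v Hv] := Dapprox u Du.
  have DTv n : D (T t (v n).1).
    have [+ _] := Hv n; case: (v n) => a h G /=.
    exact: GD (generator_orbit nP TP t0 G).
  have Dv n : D (v n).1.
    by have [+ _] := Hv n; case: (v n) => a h G /=; exact: GD G.
  have TvB m n : nrmD (T t (v m).1 - T t (v n).1) <= nrmD ((v m).1 - (v n).1).
    rewrite -(semigroupB TP)//.
    have [+ _] := Hv m; have [+ _] := Hv n.
    case: (v m) => a h; case: (v n) => a' h' G G' /=.
    exact: Gc t0 (generatorB nP TP G' G).
  have [e e0|w Dw /cvg_seq0P Hw] :=
      (let: And5 _ _ _ _ c := BD in c) (fun n => T t (v n).1) DTv.
    have e20 : 0 < e / 2 by rewrite divr_gt0.
    have [N HN] := inv_small _ e20; exists N => m n Nm Nn.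
    apply: le_lt_trans (TvB m n) _.
    apply: le_lt_trans (norm_on_triB DP (Dv m) Du (Dv n)) _.
    rewrite (norm_on_distC DP)//.
    have := lt_trans (Hv m).2 (HN m Nm); have := lt_trans (Hv n).2 (HN n Nn).
    by move=> ? ?; lra.
  have {}Hw := Hw (fun n => norm_on_ge0 DP (D_B _ _ (DTv n) Dw)).
  suff <- : w = T t u.
    split=> //; apply/ler_addgt0Pr => e e0.
    have e20 : 0 < e / 2 by rewrite divr_gt0.
    have [N HN] := inv_small _ e20; have [M HM] := Hw _ e20.
    set k := maxn N M.
    have kN := HN k (leq_maxl _ _); have kM := HM k (leq_maxr _ _).
    have [G uvk'] := Hv k; have uvk := lt_trans uvk' kN => {uvk' kN}.
    have h1 : nrmD w <= nrmD (T t (v k).1 - w) + nrmD (T t (v k).1).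
      rewrite (norm_on_distC DP)//.
      have {1}-> : w = (w - T t (v k).1) + T t (v k).1 by rewrite subrK.
      by apply: (norm_on_tri DP) => //; exact: D_B.
    have h2 : nrmD (T t (v k).1) <= nrmD (v k).1.
      by move: G; case: (v k) => a h; exact: Gc.
    have h3 : nrmD (v k).1 <= nrmD (u - (v k).1) + nrmD u.
      rewrite (norm_on_distC DP)//.
      have {1}-> : (v k).1 = ((v k).1 - u) + u by rewrite subrK.
      by apply: (norm_on_tri DP) => //; exact: D_B.
    lra.
  apply/eqP; rewrite -subr_eq0; apply/eqP.
  case: (nP) => _ def _ _; apply: def => //.
  apply/eqP; rewrite eq_le n0 andbT; apply/ler_addgt0Pr => e e0; rewrite add0r.
  have e20 : 0 < e / 2 by rewrite divr_gt0.
  have [N HN] := inv_small _ e20; have [M HM] := Hw _ e20.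
  set k := maxn N M.
  have kN := HN k (leq_maxl _ _); have kM := HM k (leq_maxr _ _).
  have [G uvk'] := Hv k; have uvk := lt_trans uvk' kN => {uvk' kN}.
  have := norm_on_triB nP (u := w) (v := T t (v k).1) (w := T t u) I I I.
  have := le _ (D_B _ _ (DTv k) Dw); rewrite (norm_on_distC nP)//.
  have := semigroup_le TP ((v k).1 - u) t0; rewrite (semigroupB TP)//.
  have := le _ (D_B _ _ Du (Dv k)); rewrite (norm_on_distC nP)//.
  lra.
case: (TP) => _ Tl [TP0 TPD] _ Tc.
split.
- by move=> t u t0 Du; case: (inv_tri t u t0 Du).
- by move=> *; exact: Tl.
- by split=> [u _|s t u s0 t0 _]; [exact: TP0|exact: TPD].
- by move=> t u t0 Du; case: (inv_tri t u t0 Du).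
move=> u Du.
(* For t < 0 the vector T t u - u need not lie in D, so that its norm may be
   negative, whence the absolute value. *)
suff : (fun t => `|nrmD (T t u - u)|) @ 0^'+ --> (0 : R) by move/norm_cvg0P.
apply/cvg_right0P => // e e0.
have e40 : 0 < e / 4 by rewrite divr_gt0.
have [v [h [G uv]]] := Gd u _ Du e40.
have Dv := GD _ _ G.
have C0 : 0 < `|C| + 1 by rewrite ltr_wpDl.
set e' := e / 4 / (`|C| + 1).
have e'0 : 0 < e' by rewrite divr_gt0.
have /cvg_right0P H1 := Tc v I; have /cvg_right0P H2 := Tc h I.
have [//|d1 d10 Hd1] := H1 _ _ e'0; have [//|d2 d20 Hd2] := H2 _ _ e'0.
exists (Num.min d1 d2); first by rewrite lt_min d10.
move=> t /andP[t0]; rewrite lt_min => /andP[td1 td2].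
have t0' := ltW t0.
have [DTu _] := inv_tri t u t0' Du; have [DTv _] := inv_tri t v t0' Dv.
rewrite ger0_norm; last by apply: (norm_on_ge0 DP); exact: D_B.
have := norm_on_triB DP DTu DTv Du.
have := norm_on_triB DP DTv Dv Du.
have : nrmD (T t u - T t v) <= nrmD (u - v).
  by rewrite -(semigroupB TP)//; case: (inv_tri t (u - v) t0' (D_B _ _ Du Dv)).
rewrite [nrmD (v - u)](norm_on_distC DP)//.
have : nrmD (T t v - v) <= e / 4 * 2.
  have := Gn _ _ (generatorB nP TP (generator_orbit nP TP t0' G) G).
  move=> /le_trans; apply.
  have := Hd1 t; rewrite t0 td1 => /(_ isT) a1.
  have := Hd2 t; rewrite t0 td2 => /(_ isT) a2.
  apply: (@le_trans _ _ ((`|C| + 1) * (e' + e'))).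
    apply: (@le_trans _ _ ((`|C| + 1) * (nrm (T t v - v) + nrm (T t h - h)))).
      apply: ler_wpM2r; first by rewrite addr_ge0.
      by apply: le_trans (ler_norm _) _; rewrite lerDl.
    by apply: ler_wpM2l; [exact: ltW|apply: lerD; exact: ltW].
  have : (`|C| + 1) * e' = e / 4 by rewrite mulrC divfK// gt_eqF.
  by move=> Ce; rewrite mulrDr Ce; lra.
move: uv; lra.
Qed.

End restriction.

(** * Square-integrable classes over a probability measure *)

Section L2_theory.
Context {d : measure_display} {S : measurableType d} {R : realType}
  {mu : probability S R}.
Implicit Types (u v : LspaceType2 mu) (f g : S -> R).

(** Monotonicity of the almost everywhere quantifier. *)
Lemma ae_filterS1 (P Q : S -> Prop) : (forall x, P x -> Q x) ->
  {ae mu, forall x, P x} -> {ae mu, forall x, Q x}.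
Proof. exact: filterS. Qed.

Lemma ae_filterS2 (P1 P2 Q : S -> Prop) : (forall x, P1 x -> P2 x -> Q x) ->
  {ae mu, forall x, P1 x} -> {ae mu, forall x, P2 x} -> {ae mu, forall x, Q x}.
Proof. exact: filterS2. Qed.

Lemma ae_filterS3 (P1 P2 P3 Q : S -> Prop) :
  (forall x, P1 x -> P2 x -> P3 x -> Q x) ->
  {ae mu, forall x, P1 x} -> {ae mu, forall x, P2 x} ->
  {ae mu, forall x, P3 x} -> {ae mu, forall x, Q x}.
Proof. exact: filterS3. Qed.

Lemma Rintegral_ae_eq f g (D : set S) : measurable D ->
  measurable_fun D f -> measurable_fun D g ->
  {ae mu, forall x, D x -> f x = g x} ->
  \int[mu]_(x in D) f x = \int[mu]_(x in D) g x.
Proof.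
move=> mD mf mg fg; congr fine; apply: ae_eq_integral => //.
- exact/measurable_EFinP.
- exact/measurable_EFinP.
- by apply: filterS fg => x fx Dx; rewrite fx.
Qed.

Lemma Rintegral_ae_ge0 f (D : set S) : measurable D ->
  mu.-integrable D (EFin \o f) ->
  {ae mu, forall x, D x -> 0 <= f x} -> 0 <= \int[mu]_(x in D) f x.
Proof.
move=> mD /integrableP[/measurable_EFinP mf _] f0.
rewrite (@Rintegral_ae_eq f (fun x => `|f x|))//.
- by apply: Rintegral_ge0.
- exact: measurableT_comp.
- by apply: filterS f0 => x fx Dx /=; rewrite ger0_norm// fx.
Qed.

Lemma le_Rintegral_ae f g (D : set S) : measurable D ->
  mu.-integrable D (EFin \o f) ->
  mu.-integrable D (EFin \o g) -> {ae mu, forall x, D x -> f x <= g x} ->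
  \int[mu]_(x in D) f x <= \int[mu]_(x in D) g x.
Proof.
move=> mD intf intg fg; rewrite -subr_ge0 -RintegralB//; apply: Rintegral_ae_ge0 => //.
  rewrite (_ : _ \o _ = (EFin \o g) \- (EFin \o f))%E//; exact: integrableB.
by apply: filterS fg => x fg Dx; rewrite subr_ge0 fg.
Qed.

Lemma integrable_EFinD f g : mu.-integrable setT (EFin \o f) ->
  mu.-integrable setT (EFin \o g) ->
  mu.-integrable setT (EFin \o (fun x => f x + g x)).
Proof.
move=> intf intg.
by rewrite (_ : _ \o _ = (EFin \o f) \+ (EFin \o g))%E//; exact: integrableD.
Qed.

Lemma integrable_EFinZ a f : mu.-integrable setT (EFin \o f) ->
  mu.-integrable setT (EFin \o (fun x => a * f x)).
Proof.
move=> intf; rewrite (_ : _ \o _ = (fun x => a%:E * (EFin \o f) x))%E//.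
exact: integrableZl.
Qed.

Lemma integrable_EFinB f g : mu.-integrable setT (EFin \o f) ->
  mu.-integrable setT (EFin \o g) ->
  mu.-integrable setT (EFin \o (fun x => f x - g x)).
Proof.
move=> intf intg.
by rewrite (_ : _ \o _ = (EFin \o f) \- (EFin \o g))%E//; exact: integrableB.
Qed.

Lemma integrable_EFin_le f g : measurable_fun setT f ->
  (forall x, `|f x| <= g x) -> mu.-integrable setT (EFin \o g) ->
  mu.-integrable setT (EFin \o f).
Proof.
move=> mf fg; apply: le_integrable => //; first exact/measurable_EFinP.
by move=> x _; rewrite /= lee_fin (le_trans (fg x))// ler_norm.
Qed.

Lemma Rintegral_cstT (c : R) : \int[mu]_(x in setT) c = c.
Proof.
rewrite Rintegral_cst//; have := probability_setT mu => /= mu1.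
by rewrite [X in fine X]mu1 mulr1.
Qed.

Lemma L2_measurable u : measurable_fun setT (u : S -> R).
Proof. exact: measurable_L2. Qed.

Lemma L2_integrable_sqr u : mu.-integrable setT (EFin \o (fun x => u x ^+ 2)).
Proof. exact: Lfun2_integrable_sqr (L2_Lfun u). Qed.

Lemma L2_integrable u : mu.-integrable setT (EFin \o (u : S -> R)).
Proof.
apply/Lfun1_integrable/(Lfun_subset12 _ (L2_Lfun u)).
exact: fin_num_measure.
Qed.

Lemma L2_of_Lfun f : f \in Lfun mu 2%:R%:E ->
  exists u : LspaceType2 mu, (u : S -> R) = f %[ae mu].
Proof.
by move=> fL; exists (L2_class (Lfun_Sub (lee1n 2) fL)); exact: L2_classE.
Qed.

Lemma L2_of_bounded f (M : R) : measurable_fun setT f -> (forall x, `|f x| <= M) ->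
  exists u : LspaceType2 mu, (u : S -> R) = f %[ae mu].
Proof.
move=> mf fM; apply: L2_of_Lfun; apply/andP; split; rewrite inE//=.
rewrite /finite_norm unlock poweR_lty//.
apply: (@le_lt_trans _ _ (\int[mu]_x (cst (M ^+ 2)%:E x))%E); last first.
  by rewrite integral_cst//= probability_setT mule1 ltry.
apply: ge0_le_integral => //=.
- apply/measurable_EFinP; apply: (measurableT_comp (measurable_powR _)).
  exact: measurableT_comp.
- by move=> x _; rewrite powR_mulrn// lee_fin lerXn2r// nnegrE (le_trans _ (fM x)).
Qed.

Lemma L2norm_sqr u : L2norm mu u ^+ 2 = \int[mu]_x (u x ^+ 2).
Proof.
have h := @finite_norm_fine _ _ _ mu _ (lee1n 2) (L2_repr u).
rewrite /L2norm /Rintegral -[LHS]/(fine (_%:E)); congr fine.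
have := @poweR_Lnorm _ _ _ mu (EFin \o (u : S -> R)) 2%:R.
rewrite pnatr_eq0 -[in X in X -> _]h => /(_ isT).
rewrite poweR_EFin powR_mulrn ?fine_ge0 ?Lnorm_ge0// => ->.
by apply: eq_integral => x _ /=; rewrite powR_mulrn// real_normK ?num_real.
Qed.

Lemma L2norm_ge0 u : 0 <= L2norm mu u.
Proof. by rewrite fine_ge0// Lnorm_ge0. Qed.

Lemma L2norm_le u (M : R) : 0 <= M ->
  \int[mu]_x (u x ^+ 2) <= M ^+ 2 -> L2norm mu u <= M.
Proof.
by move=> M0; rewrite -L2norm_sqr ler_sqr// nnegrE L2norm_ge0.
Qed.

Lemma L2norm_ae_bound u (M : R) : 0 <= M -> {ae mu, forall x, `|u x| <= M} ->
  L2norm mu u <= M.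
Proof.
move=> M0 uM; apply: L2norm_le => //.
have -> : M ^+ 2 = \int[mu]_x (cst (M ^+ 2) x).
  by rewrite Rintegral_cstT.
apply: le_Rintegral_ae => //; first exact: L2_integrable_sqr.
  exact: finite_measure_integrable_cst.
by apply: filterS uM => x uxM _; rewrite -real_normK ?num_real// lerXn2r ?nnegrE.
Qed.

Lemma L1_le_L2norm u : \int[mu]_x `|u x| <= L2norm mu u.
Proof.
have intu : mu.-integrable setT (EFin \o (fun x => `|u x|)).
  exact: integrable_abse (L2_integrable u).
set m := \int[mu]_x _; have m0 : 0 <= m by exact: Rintegral_ge0.
rewrite -ler_sqr ?nnegrE ?L2norm_ge0// L2norm_sqr.
(* the variance of |u| is nonnegative *)
have : 0 <= \int[mu]_x (u x ^+ 2 + (- (2 * m) * `|u x| + m ^+ 2)).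
  apply: Rintegral_ge0 => x _.
  rewrite -(real_normK (num_real (u x))).
  by have := sqr_ge0 (`|u x| - m); rewrite sqrrB; lra.
rewrite RintegralD//; first 1 last.
- exact: L2_integrable_sqr.
- apply: integrable_EFinD; first exact: integrable_EFinZ.
  exact: finite_measure_integrable_cst.
rewrite RintegralD//; first 1 last.
- exact: integrable_EFinZ.
- exact: finite_measure_integrable_cst.
rewrite RintegralZl// -/m Rintegral_cstT.
by rewrite mulNr -mulrA -expr2; lra.
Qed.

Lemma L2norm_on : norm_on setT (L2norm mu).
Proof.
have aeN (f g : S -> R) : measurable_fun setT f -> measurable_fun setT g ->
    f = g %[ae mu] -> fine ('N[mu]_2%:R%:E[EFin \o f])%E =
    fine ('N[mu]_2%:R%:E[EFin \o g])%E.
  move=> mf mg fg; congr fine; rewrite unlock; congr (_ `^ _)%E.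
  apply: ae_eq_integral => //.
  - apply/measurable_EFinP; apply: (measurableT_comp (measurable_powR _)).
    exact: measurableT_comp.
  - apply/measurable_EFinP; apply: (measurableT_comp (measurable_powR _)).
    exact: measurableT_comp.
  - by apply: filterS fg => x /(_ I) fx _ /=; rewrite fx.
split => //.
- move=> u _ u0; apply/L2_eqP.
  have := @fine_Lnormr_eq0 _ _ _ mu _ (lee1n 2) (L2_repr u) u0.
  move=> h; move: (@L2_zeroE _ _ _ mu) h; apply: filterS2 => x /(_ I) z /(_ I) ux _.
  by rewrite [LHS]ux [RHS]z.
- move=> a u _.
  apply: EFin_inj; rewrite EFinM.
  rewrite [in RHS](@finite_norm_fine _ _ _ mu _ (lee1n 2) (L2_repr u)).
  rewrite -(LnormZ (L2_repr u) a).
  rewrite -(@finite_norm_fine _ _ _ mu _ (lee1n 2) (a *: L2_repr u)).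
  congr EFin; apply: aeN => //; [exact: L2_measurable|exact: L2_scaleE].
- move=> u v _ _.
  apply: le_trans (ler_LnormD (L2_repr u) (L2_repr v)).
  rewrite le_eqVlt; apply/orP; left; apply/eqP.
  by apply: aeN => //; [exact: L2_measurable|exact: L2_addE].
Qed.

End L2_theory.

(** * Continuous functions on the support of the measure *)

Section continuous_on_support.
Context {R : realType} {mu : probability (measurableTypeR R) R}.
Implicit Types (u v : LspaceType2 mu) (f g : R -> R) (b : boundary).

Local Notation I01 := (`[0, 1]%classic : set R).

Lemma within_continuousP (A : set R) g : {within A, continuous g} <->
  forall x, A x -> forall e : R, 0 < e -> exists2 d : R, 0 < d &
    forall y, A y -> `|y - x| < d -> `|g y - g x| < e.
Proof.
split.
- move=> /subspace_continuousP gc x Ax e e0.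
  have /cvgrPdist_lt/(_ e e0) := gc x Ax.
  rewrite near_withinE => /nbhs_ballP[d /= d0 H]; exists d => // y Ay yx.
  by rewrite distrC; apply: H => //; rewrite /ball /= distrC.
- move=> H; apply/subspace_continuousP => x Ax; apply/cvgrPdist_lt => e e0.
  have [d d0 Hd] := H x Ax e e0.
  rewrite near_withinE; apply/nbhs_ballP; exists d => //= y.
  by rewrite /ball /= distrC => yx Ay; rewrite distrC; exact: Hd.
Qed.

Lemma within_continuous_bounded g : {within I01, continuous g} ->
  exists M : R, forall x, I01 x -> `|g x| <= M.
Proof.
move=> gc; have gcN : {within I01, continuous (fun x => - g x)}.
  move=> x; exact: cvgN (gc x).
have [c _ Hc] := EVT_max (@ler01 R) gc.
have [c' _ Hc'] := EVT_max (@ler01 R) gcN.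
exists (Num.max (g c) (- g c')) => x xI; rewrite ler_norml le_max lerNl le_max.
by rewrite Hc// Hc' ?orbT.
Qed.

Lemma within_continuousS (A B : set R) g : A `<=` B ->
  {within B, continuous g} -> {within A, continuous g}.
Proof.
move=> AB /within_continuousP gc; apply/within_continuousP => x Ax e e0.
have [d d0 H] := gc x (AB _ Ax) e e0; exists d => // y Ay.
exact: H (AB _ Ay).
Qed.

Lemma within_continuous_lin (A : set R) a f g : {within A, continuous f} ->
  {within A, continuous g} -> {within A, continuous (fun x => a * f x + g x)}.
Proof.
move=> fc gc x; apply: cvgD (gc x).
exact: (cvgM (cvg_cst a) (fc x)).
Qed.

Lemma representative_lin a u v f g : representative u f -> representative v g ->
  representative (a *: u + v) (fun x => a * f x + g x).
Proof.
move=> uf vg.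
have h1 : ((a *: u + v : LspaceType2 mu) : R -> R) = (fun x => (a *: u) x + v x) %[ae mu]
  by exact: L2_addE.
have h2 : ((a *: u : LspaceType2 mu) : R -> R) = (fun x => a * u x) %[ae mu]
  by exact: L2_scaleE.
have h12 : ((a *: u + v : LspaceType2 mu) : R -> R) = (fun x => a * u x + v x) %[ae mu].
  by apply: ae_filterS2 h1 h2 => x /(_ I) e1 /(_ I) e2 _; rewrite e1 e2.
by apply: ae_filterS3 h12 uf vg => x /(_ I) -> /(_ I) -> /(_ I) ->.
Qed.

Lemma msupport_closed : closed (msupport mu).
Proof.
move=> x cx U oU Ux.
have [y [sy Uy]] := cx _ (open_nbhs_nbhs (conj oU Ux)).
exact: sy.
Qed.

(** Almost every point lies in the support, because the complement of the
    support is a union of countably many null intervals with rational end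
    points. *)
Lemma ae_msupport : {ae mu, forall x, msupport mu x}.
Proof.
pose U n : set R := if @unpickle (rat * rat)%type n is Some (p, q) then
  (if mu `]ratr p, ratr q[%classic == 0%E then `]ratr p, ratr q[%classic else set0)
  else set0.
have nU : mu.-negligible (\bigcup_n U n).
  apply: negligible_bigcup => n; rewrite /U.
  case: unpickle => [[p q]|]; last exact: negligible_set0.
  case: eqP => [p0|_]; last exact: negligible_set0.
  by apply/negligibleP => //; exact: measurable_itv.
apply: negligibleS nU => x /=.
move=> /existsNP[V /not_implyP[oV /not_implyP[Vx /negP]]].
rewrite -leNgt => muV0.
have /nbhs_ballP[d /= d0 dV] := open_nbhs_nbhs (conj oV Vx).
have [p] : exists p : rat, ratr p \in `]x - d, x[.
  by apply: rat_in_itvoo; rewrite gtrBl.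
rewrite in_itv /= => /andP[p1 p2].
have [q] : exists q : rat, ratr q \in `]x, x + d[.
  by apply: rat_in_itvoo; rewrite ltrDl.
rewrite in_itv /= => /andP[q1 q2].
exists (pickle (p, q)); first exact: I.
rewrite /U pickleK.
have -> : mu `]ratr p, ratr q[%classic = 0%E.
  apply/eqP; rewrite eq_le measure_ge0 andbT.
  apply: le_trans muV0; apply: le_measure; rewrite ?inE//.
  - exact: open_measurable.
  - move=> y /=; rewrite in_itv /= => /andP[py yq]; apply: dV.
    by rewrite /ball /= ltr_distlC; apply/andP; split; lra.
by rewrite eqxx /= in_itv /= p2.
Qed.

Context (mu01 : mu I01 = 1%E).

Lemma negligible_off01 : mu.-negligible (~` I01).
Proof.
apply/negligibleP; first by apply: measurableC; exact: measurable_itv.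
have := @probability_setC _ _ _ mu I01 (measurable_itv _).
by rewrite mu01 subee.
Qed.

Lemma msupport_sub01 : msupport mu `<=` I01.
Proof.
move=> x sx; apply: contrapT => nx.
have cI : closed I01 by exact: itv_closed.
have := sx (~` I01) (closed_openC cI) nx.
have /negligibleP := negligible_off01.
move=> -> //; first by rewrite ltxx.
by apply: measurableC; exact: measurable_itv.
Qed.

(** A closed inequality between continuous functions that holds almost
    everywhere holds on the whole support. *)
Lemma ae_le_msupport g (M : R) : {within I01, continuous g} ->
  {ae mu, forall x, g x <= M} -> forall x, msupport mu x -> g x <= M.
Proof.
move=> /within_continuousP gc gM x sx; rewrite leNgt; apply/negP => Mg.
have Ix := msupport_sub01 sx.
have [|d d0 H] := gc x Ix (g x - M); first by rewrite subr_gt0.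
have := sx (ball x d) (ball_open _ _) (ballxx _ d0).
suff : mu.-negligible (ball x d).
  by move=> /negligibleP -> //; [rewrite ltxx|exact: measurable_ball].
apply: (negligibleS _ (negligibleU gM negligible_off01)) => y.
rewrite /ball /= distrC => yx; case: (pselect (I01 y)) => Iy; last by right.
left => /= gyM; have := H y Iy yx; rewrite ltr_norml; lra.
Qed.

Lemma ae_eq_msupport f g : {within I01, continuous f} ->
  {within I01, continuous g} -> f = g %[ae mu] ->
  forall x, msupport mu x -> f x = g x.
Proof.
move=> fc gc fg x sx; apply/eqP; rewrite eq_le.
have h1 := @within_continuous_lin _ (-1) _ _ gc fc.
have h2 := @within_continuous_lin _ (-1) _ _ fc gc.
apply/andP; split.
- have := @ae_le_msupport _ 0 h1 _ x sx; rewrite mulN1r addrC subr_le0; apply.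
  by apply: ae_filterS1 fg => y /(_ I) ->; rewrite mulN1r addrC subrr.
- have := @ae_le_msupport _ 0 h2 _ x sx; rewrite mulN1r addrC subr_le0; apply.
  by apply: ae_filterS1 fg => y /(_ I) ->; rewrite mulN1r addrC subrr.
Qed.

Lemma continuous_representative_lin b a u v f g :
  continuous_representative b u f -> continuous_representative b v g ->
  continuous_representative b (a *: u + v) (fun x => a * f x + g x).
Proof.
move=> [uf fc f0] [vg gc g0]; split.
- exact: representative_lin.
- exact: within_continuous_lin.
- by case: b f0 g0 => // -[-> ->] [-> ->]; rewrite mulr0 addr0.
Qed.

Lemma continuous_representativeB b u v f g :
  continuous_representative b u f -> continuous_representative b v g ->
  continuous_representative b (u - v) (fun x => f x - g x).
Proof.
move=> uf vg; have := continuous_representative_lin (-1) vg uf.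
rewrite scaleN1r addrC (_ : (fun x => _) = (fun x => f x - g x))//.
by apply/funext => x; rewrite mulN1r addrC.
Qed.

Lemma Cmu_lin b a u v : Cmu mu b u -> Cmu mu b v -> Cmu mu b (a *: u + v).
Proof.
move=> [f uf] [g vg]; exists (fun x => a * f x + g x).
exact: continuous_representative_lin.
Qed.

Context (supp0 : msupport mu 0) (supp1 : msupport mu 1).

Section Cmu_norm_theory.
Context {b : boundary} {u : LspaceType2 mu} {g : R -> R}.
Hypothesis ug : continuous_representative b u g.

Let g0 := xget (cst 0) (continuous_representative b u).

Let g0P : continuous_representative b u g0.
Proof. by apply: xgetPex; exists g. Qed.

Let g0E x : msupport mu x -> g0 x = g x.
Proof.
case: ug g0P => ug' gc _ [ug0 g0c _]; apply: ae_eq_msupport => //.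
by apply: ae_eq_trans ug'; exact: ae_eq_sym.
Qed.

Lemma Cmu_norm_ub x : msupport mu x -> `|g x| <= Cmu_norm mu b u.
Proof.
move=> sx; apply: ub_le_sup; last by exists x => //; rewrite -/g0 g0E.
have [M HM] := within_continuous_bounded (let: And3 _ c _ := ug in c).
exists M => _ [y sy <-]; rewrite -/g0 g0E//; apply: HM; exact: msupport_sub01.
Qed.

Lemma Cmu_norm_le (M : R) : (forall x, msupport mu x -> `|g x| <= M) ->
  Cmu_norm mu b u <= M.
Proof.
move=> gM; apply: ge_sup; first by exists `|g0 0|; exists 0.
by move=> _ [y sy <-]; rewrite -/g0 g0E//; exact: gM.
Qed.

Lemma L2norm_le_Cmu_norm : L2norm mu u <= Cmu_norm mu b u.
Proof.
apply: L2norm_ae_bound; first by apply: le_trans (Cmu_norm_ub supp0).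
have [ug' _ _] := ug.
by apply: ae_filterS2 ug' ae_msupport => x /(_ I) -> sx; exact: Cmu_norm_ub.
Qed.

End Cmu_norm_theory.

Lemma Cmu_norm_on b : norm_on (Cmu mu b) (Cmu_norm mu b).
Proof.
split.
- split; last by move=> a u v; exact: Cmu_lin.
  exists (cst 0); split; [exact: L2_zeroE| |by case: b].
  by move=> x; exact: cvg_cst.
- move=> u [g ug] u0; apply/L2_eqP; have [ug' _ _] := ug.
  move: (@L2_zeroE _ _ _ mu) ug' ae_msupport.
  apply: ae_filterS3 => x /(_ I) z /(_ I) ux sx _; rewrite [LHS]ux [RHS]z.
  by apply/eqP; rewrite -normr_le0 -u0; exact: (Cmu_norm_ub ug).
- move=> a u [g ug].
  have aug : continuous_representative b (a *: u) (fun x => a * g x).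
    case: ug => ug gc g0; split.
    + have : ((a *: u : LspaceType2 mu) : R -> R) = (fun x => a * u x) %[ae mu]
        by exact: L2_scaleE.
      by move: ug; apply: ae_filterS2 => x /(_ I) -> /(_ I) ->.
    + by move=> x; exact: (cvgM (cvg_cst a) (gc x)).
    + by case: b g0 => // -[-> ->]; rewrite mulr0.
  apply/eqP; rewrite eq_le; apply/andP; split.
    apply: (Cmu_norm_le aug) => x sx; rewrite normrM ler_wpM2l//.
    exact: (Cmu_norm_ub ug).
  move: aug; have [-> aug|a0 aug] := eqVneq a 0.
    rewrite normr0 mul0r; exact: le_trans (normr_ge0 _) (Cmu_norm_ub aug supp0).
  rewrite -ler_pdivlMl ?normr_gt0//; apply: (Cmu_norm_le ug) => x sx.
  by rewrite ler_pdivlMl ?normr_gt0// -normrM; exact: (Cmu_norm_ub aug).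
- move=> u v [f uf] [g vg].
  have := continuous_representative_lin 1 uf vg; rewrite scale1r => uvfg.
  apply: (Cmu_norm_le uvfg) => x sx; rewrite mul1r (le_trans (ler_normD _ _))//.
  by apply: lerD; [exact: (Cmu_norm_ub uf)|exact: (Cmu_norm_ub vg)].
Qed.

(** Completeness: the continuous representatives of a Cauchy sequence converge
    uniformly on the closed support, and the limit extends continuously to the
    line by Tietze's theorem. *)
Lemma Cmu_banach b : banach_subspace (Cmu mu b) (Cmu_norm mu b).
Proof.
have CP := Cmu_norm_on b; case: (CP) => C1 C2 C3 C4; split => // s Ds sC.
have [g gP] := choice Ds.
have dist m n x : msupport mu x ->
    `|g m x - g n x| <= Cmu_norm mu b (s m - s n).
  exact: (Cmu_norm_ub (continuous_representativeB (gP m) (gP n))).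
pose f x := lim (g n x @[n --> \oo]).
have fE x : msupport mu x -> g n x @[n --> \oo] --> f x.
  move=> sx; suff : cvg (g n x @[n --> \oo]) by [].
  apply/cauchy_cvgP/cauchy_exP => e e0.
  have [N HN] := sC _ e0; exists (g N x), N => // n Nn.
  by rewrite /ball /=; apply: le_lt_trans (dist _ _ _ sx) _; exact: HN.
have fu (e : R) : 0 < e -> exists N, forall n, (N <= n)%N -> forall x,
    msupport mu x -> `|g n x - f x| <= e.
  move=> e0; have [N HN] := sC _ e0; exists N => n Nn x sx.
  have gnf : (fun m => `|g n x - g m x|) @ \oo --> `|g n x - f x|.
    by apply: cvg_norm; apply: cvgB; [exact: cvg_cst|exact: fE].
  rewrite -(cvg_lim (@Rhausdorff R) gnf).
  apply: limr_le; [exact: cvgP gnf|exists N => // m Nm /=].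
  by apply: le_trans (dist _ _ _ sx) _; apply/ltW/HN.
have fc : {within msupport mu, continuous f}.
  apply/within_continuousP => x sx e e0.
  have e30 : 0 < e / 3 by rewrite divr_gt0.
  have [N HN] := fu _ e30; have {}HN := HN N (leqnn N).
  have [_ /within_continuousP gc _] := gP N.
  have [d d0 Hd] := gc x (msupport_sub01 sx) _ e30.
  exists d => // y sy yx.
  have := Hd y (msupport_sub01 sy) yx; have := HN x sx; have := HN y sy.
  by rewrite !ler_norml !ltr_norml; lra.
have [N0 HN0] := fu _ ltr01; have {}HN0 := HN0 N0 (leqnn _).
pose M := Cmu_norm mu b (s N0) + 1.
have fM x : msupport mu x -> `|f x| <= M.
  move=> sx; have := HN0 x sx; have := Cmu_norm_ub (gP N0) sx.
  by rewrite /M !ler_norml; lra.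
have M0 : 0 < M.
  rewrite /M ltr_wpDl//; exact: le_trans (normr_ge0 _) (Cmu_norm_ub (gP N0) supp0).
have [h [fh hc hM]] : exists h : R -> R, [/\ {in msupport mu, f =1 h},
    continuous h & forall x, `|h x| <= M].
  exact: continuous_bounded_extension pseudometric_normal _ msupport_closed _ _
    M0 fc fM.
have [u uh] : exists u : LspaceType2 mu, (u : R -> R) = h %[ae mu].
  apply: (@L2_of_bounded _ (measurableTypeR R) R mu h M) => //.
  exact: continuous_measurable_fun.
have uP : continuous_representative b u h.
  split => //; first by apply: continuous_subspaceT.
  have lim0 x : msupport mu x -> (forall n, g n x = 0) -> h x = 0.
    move=> sx gx; rewrite -fh ?inE//; apply: cvg_lim => //.
    by rewrite (_ : (fun n => _) = cst 0); [exact: cvg_cst|apply/funext].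
  have gP' n : b = Dirichlet -> g n 0 = 0 /\ g n 1 = 0.
    by move: (gP n) => [_ _ +] bD; rewrite bD.
  move: gP'; case: (b) => // /(_ _ erefl) gP'.
  by split; apply: lim0 => // n; case: (gP' n).
exists u; first by exists h.
apply/cvg_seq0P.
  by move=> n; apply: (norm_on_ge0 CP); apply: (norm_onB CP) => //; exists h.
move=> e e0; have e20 : 0 < e / 2 by rewrite divr_gt0.
have [N HN] := fu _ e20; exists N => n Nn.
apply: (@le_lt_trans _ _ (e / 2)); last by lra.
apply: (Cmu_norm_le (continuous_representativeB (gP n) uP)) => x sx.
by rewrite -fh ?inE//; exact: HN.
Qed.

End continuous_on_support.

(** * Functions whose derivative has a mu-derivative *)

Section mu_derivative.
Context {R : realType} {mu : probability (measurableTypeR R) R}.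
Implicit Types (u h : LspaceType2 mu) (f : R -> R) (b : boundary).

Local Notation I01 := (`[0, 1]%classic : set R).

Lemma derivative01P f f1 : derivative01 f f1 <->
  forall x, I01 x -> forall e : R, 0 < e -> exists2 d : R, 0 < d &
    forall y, I01 y -> `|y - x| < d ->
      `|f y - f x - f1 x * (y - x)| <= e * `|y - x|.
Proof.
split.
- move=> H x Ix e e0; have /cvgrPdist_lt/(_ e e0) := H x Ix.
  rewrite near_withinE near_withinE => /nbhs_ballP[d /= d0 Hd].
  exists d => // y Iy yx; have [->|yNx] := eqVneq y x.
    by rewrite !subrr mulr0 subr0 normr0 mulr0.
  have := Hd y; rewrite /ball /= distrC => /(_ yx yNx Iy) /ltW.
  have yx0 : 0 < `|y - x| by rewrite normr_gt0 subr_eq0.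
  by rewrite -(ler_pM2r yx0) -normrM mulrBl divfK ?subr_eq0// distrC.
- move=> H x Ix; apply/cvgrPdist_lt => e e0.
  have e20 : 0 < e / 2 by rewrite divr_gt0.
  have [d d0 Hd] := H x Ix _ e20.
  rewrite near_withinE near_withinE; apply/nbhs_ballP; exists d => //= y.
  rewrite /ball /= distrC => yx yNx Iy.
  have yx0 : 0 < `|y - x| by rewrite normr_gt0 subr_eq0.
  have := Hd y Iy yx; rewrite -ler_pdivrMr// -normfV -normrM mulrBl mulfK ?subr_eq0//.
  by rewrite distrC => /le_lt_trans; apply; lra.
Qed.

Lemma I01P (x : R) : I01 x <-> 0 <= x <= 1.
Proof. by rewrite /= in_itv. Qed.

Lemma derivative01_continuous f f1 : derivative01 f f1 -> {within I01, continuous f}.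
Proof.
move=> /derivative01P H; apply/within_continuousP => x Ix e e0.
have [d d0 Hd] := H x Ix 1 ltr01.
set K := `|f1 x| + 1; have K0 : 0 < K by rewrite /K ltr_wpDl.
exists (Num.min d (e / K)); first by rewrite lt_min d0 divr_gt0.
move=> y Iy; rewrite lt_min => /andP[yx yx'].
have := Hd y Iy yx; rewrite mul1r => h1.
have h2 : `|f y - f x| <= K * `|y - x|.
  have -> : f y - f x = (f y - f x - f1 x * (y - x)) + f1 x * (y - x) by rewrite subrK.
  apply: le_trans (ler_normD _ _) _; rewrite normrM /K mulrDl mul1r addrC.
  by rewrite lerD2l.
by apply: le_lt_trans h2 _; rewrite mulrC -ltr_pdivlMr.
Qed.

Lemma derivative01_MVT f f1 x y : derivative01 f f1 -> 0 <= x -> x < y -> y <= 1 ->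
  exists2 c, x < c < y & f y - f x = f1 c * (y - x).
Proof.
move=> ff1 x0 xy y1; have fc := derivative01_continuous ff1.
have /derivative01P H := ff1.
have xyI : `[x, y]%classic `<=` I01.
  by move=> z /=; rewrite !in_itv /= => /andP[? ?]; apply/andP; split; lra.
have [||c] := @MVT _ f f1 x y xy; [|exact: within_continuousS fc|].
  move=> c; rewrite in_itv /= => /andP[xc cy].
  have Ic : I01 c by apply/I01P; apply/andP; split; lra.
  suff fc' : h^-1 *: ((f \o shift c) (h *: 1) - f c) @[h --> 0^'] --> f1 c.
    by apply: DeriveDef; [apply/cvg_ex; exists (f1 c)|exact: cvg_lim fc'].
  apply/cvgrPdist_lt => e e0.
  have e20 : 0 < e / 2 by rewrite divr_gt0.
  have [d d0 Hd] := H c Ic _ e20.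
  rewrite near_withinE; apply/nbhs_ballP.
  exists (Num.min d (Num.min (c - x) (y - c))).
    by rewrite /= !lt_min d0 !subr_gt0 xc.
  move=> h /=; rewrite /ball /= sub0r normrN !lt_min => /and3P[hd hx hy] h0.
  have Ih : I01 (h + c).
    by move: hx hy; rewrite !ltr_norml => /andP[? ?] /andP[? ?];
      apply/I01P; apply/andP; split; lra.
  have := Hd (h + c) Ih; rewrite addrK => /(_ hd).
  have nh0 : 0 < `|h| by rewrite normr_gt0.
  rewrite -ler_pdivrMr// -normfV -normrM mulrBl mulfK// distrC /= /GRing.scale /=.
  by rewrite mulr1 [h^-1 * _]mulrC => /le_lt_trans; apply; lra.
by rewrite in_itv /= => cxy E; exists c.
Qed.

(** If the increments of G are at most those of V multiplied by the length of
    the interval, up to a constant factor, then G 1 <= G 0: sum over a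
    subdivision into n equal parts and let n tend to infinity. *)
Lemma increments_le0 (G V : R -> R) (K : R) :
  (forall x y : R, 0 <= x -> x < y -> y <= 1 -> G y - G x <= K * (y - x) * (V y - V x)) ->
  G 1 <= G 0.
Proof.
move=> H.
have main n : G 1 - G 0 <= K * n.+1%:R^-1 * (V 1 - V 0).
  have n0 : 0 < n.+1%:R :> R by [].
  have step k : (k <= n.+1)%N ->
      G (k%:R / n.+1%:R) - G 0 <= K * n.+1%:R^-1 * (V (k%:R / n.+1%:R) - V 0).
    elim: k => [_|k IH kn]; first by rewrite mul0r !subrr mulr0.
    have {}IH := IH (ltnW kn).
    have := H (k%:R / n.+1%:R) (k.+1%:R / n.+1%:R).
    rewrite divr_ge0// ltr_pM2r ?invr_gt0// ltr_nat ltnSn ler_pdivrMr// mul1r ler_nat.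
    rewrite kn => /(_ isT isT isT); rewrite -mulrBl -natrB// subSnn mul1r.
    move: IH; set w := K * _; lra.
  by have := step n.+1 (leqnn _); rewrite divff ?gt_eqF.
rewrite leNgt; apply/negP => G01.
set e := G 1 - G 0; have e0 : 0 < e by rewrite subr_gt0.
have := truncnS_gt (K * (V 1 - V 0) / e); set n := Num.truncn _ => nK.
have := main n; rewrite -/e mulrAC ler_pdivlMr// leNgt => /negP; apply.
by rewrite [ltRHS]mulrC -ltr_pdivrMr.
Qed.

Context (mu01 : mu I01 = 1%E) (mu_atomless : atomless mu).

Lemma Rintegral_I01 (g : R -> R) : measurable_fun setT g ->
  \int[mu]_(x in I01) g x = \int[mu]_x g x.
Proof.
move=> mg; rewrite Rintegral_mkcond; apply: Rintegral_ae_eq => //.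
  apply/(measurable_restrictT _ _).1 => //.
  by apply: measurable_funS mg.
apply: (@ae_filterS1 _ _ _ mu (fun x => I01 x)) => [x Ix _|].
  by rewrite patchE mem_set.
exact: (negligible_off01 mu01).
Qed.

Lemma Rintegral_at0 (g : R -> R) : \int[mu]_(x in `[0, 0]) g x = 0.
Proof.
rewrite set_itv1 /Rintegral null_set_integral//; last exact: mu_atomless.
exact: measurable_fun_set1.
Qed.

Lemma Rintegral_itv_split (g : R -> R) x y : mu.-integrable setT (EFin \o g) ->
  0 <= x -> x <= y ->
  \int[mu]_(z in `[0, y]) g z - \int[mu]_(z in `[0, x]) g z =
  \int[mu]_(z in `]x, y]) g z.
Proof.
move=> intg x0 xy.
rewrite (@itv_bndbnd_setU _ _ (BLeft 0) (BRight x) (BRight y)) ?bnd_simp//.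
rewrite Rintegral_setU//; first by rewrite addrAC subrr add0r.
- apply: integrableS intg => //; apply: measurableU; exact: measurable_itv.
- apply/disj_setPS => z [/=]; rewrite !in_itv /= => /andP[_ zx] /andP[xz _].
  by move: zx; rewrite leNgt xz.
Qed.

Section D2_theory.
Context {f f1 : R -> R} {h : LspaceType2 mu}.
Hypothesis fD2 : D2 f f1 h.

(** The distribution function of the measure |h| mu, whose increments dominate
    those of f'. *)
Let V (x : R) := \int[mu]_(y in `[0, x]) `|h y|.

Let abs_h_int : mu.-integrable setT (EFin \o (fun x => `|h x|)).
Proof. exact: integrable_abse (L2_integrable h). Qed.

Let V_mono x y : 0 <= x -> x <= y -> V x <= V y.
Proof.
move=> x0 xy; rewrite -subr_ge0 /V Rintegral_itv_split//.
exact: Rintegral_ge0.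
Qed.

Let V1 : V 1 <= L2norm mu h.
Proof.
apply: le_trans (L1_le_L2norm h); rewrite /V -Rintegral_I01//.
exact: measurableT_comp (L2_measurable h).
Qed.

Let f1_var x y : 0 <= x -> x <= y -> y <= 1 -> `|f1 y - f1 x| <= V y - V x.
Proof.
move=> x0 xy y1; case: fD2 => _ _ E.
have Ix : I01 x by apply/I01P; apply/andP; split; lra.
have Iy : I01 y by apply/I01P; apply/andP; split; lra.
rewrite (E y Iy) (E x Ix) opprD addrACA subrr add0r.
rewrite /V !Rintegral_itv_split//; last exact: L2_integrable.
apply: le_normr_Rintegral; first exact: measurable_itv.
by apply: integrableS (L2_integrable h) => //; exact: measurable_itv.
Qed.

Let f1_var' x y : I01 x -> I01 y -> `|f1 y - f1 x| <= L2norm mu h.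
Proof.
move=> /I01P/andP[x0 x1] /I01P/andP[y0 y1]; apply: le_trans V1.
have V0 : 0 <= V 0 by apply: Rintegral_ge0.
have [xy|/ltW xy] := leP x y.
  have := f1_var x0 xy y1; have := V_mono (lexx 0) x0; have := V_mono y0 y1; lra.
rewrite distrC.
have := f1_var y0 xy x1; have := V_mono (lexx 0) y0; have := V_mono x0 x1; lra.
Qed.

Lemma D2_continuous : {within I01, continuous f}.
Proof. by case: fD2 => /derivative01_continuous. Qed.

(** Under either boundary condition f' vanishes somewhere, so |f'| is at most
    the L^1-norm of h, hence at most its L^2-norm. *)
Lemma D2_oscillation b x y : boundary_condition b f f1 -> I01 x -> I01 y ->
  `|f y - f x| <= L2norm mu h.
Proof.
case: fD2 => ff1 _ _ bc Ix Iy.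
(* the derivative vanishes somewhere, by Rolle in the Dirichlet case *)
have [z Iz z0] : exists2 z, I01 z & f1 z = 0.
  case: b bc => [[f10 _]|[f0 fl1]].
    by exists 0 => //; apply/I01P; rewrite lexx ler01.
  have [c /andP[c0 c1]] := derivative01_MVT ff1 (lexx 0) ltr01 (lexx 1).
  rewrite f0 fl1 !subr0 mulr1 => E; exists c => //.
  by apply/I01P; rewrite !ltW.
have f1le c : I01 c -> `|f1 c| <= L2norm mu h.
  by move=> Ic; rewrite -[f1 c]subr0 -z0; exact: f1_var'.
have lip s t : 0 <= s -> s < t -> t <= 1 -> `|f t - f s| <= L2norm mu h.
  move=> s0 st t1; have [c /andP[sc ct] ->] := derivative01_MVT ff1 s0 st t1.
  rewrite normrM; apply: le_trans (_ : L2norm mu h * 1 <= _); last by rewrite mulr1.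
  apply: ler_pM => //; first by apply: f1le; apply/I01P; apply/andP; split; lra.
  by rewrite ger0_norm; lra.
move/I01P/andP: Ix => [x0 x1]; move/I01P/andP: Iy => [y0 y1].
have [xy|yx|->] := ltgtP x y; first exact: lip.
- by rewrite distrC; exact: lip.
- by rewrite subrr normr0; exact: L2norm_ge0.
Qed.

(** The uniform norm is controlled by the graph norm. *)
Lemma D2_sup_le b u x : representative u f -> boundary_condition b f f1 -> I01 x ->
  `|f x| <= L2norm mu u + L2norm mu h.
Proof.
move=> uf bc Ix; rewrite -lerBlDr; apply: le_trans (L1_le_L2norm u).
rewrite -[leLHS](@Rintegral_cstT _ _ _ mu).
apply: le_Rintegral_ae => //.
- exact: finite_measure_integrable_cst.
- exact: integrable_abse (L2_integrable u).
have uf' : {ae mu, forall y, I01 y} by exact: negligible_off01.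
apply: ae_filterS2 uf uf' => y /(_ I) -> Iy _.
have := D2_oscillation bc Iy Ix.
by have := lerB_dist (f x) (f y); lra.
Qed.

(** Dissipativity: the positive part of f - M pairs nonpositively with the
    mu-derivative of f'.  Integrating by parts, the boundary terms vanish and
    the rest is minus the integral of (f')^2 over the set where f exceeds M.
    The integration by parts is carried out on increments over small
    intervals. *)
Lemma D2_dissipative b u (M : R) : representative u f ->
  boundary_condition b f f1 -> 0 <= M ->
  \int[mu]_x (Num.max (u x - M) 0 * h x) <= 0.
Proof.
move=> uf bc M0; have [ff1 _ _] := fD2.
(* w is continuous on [0, 1]; W is equal to it almost everywhere and is
   measurable on the line *)
pose w x := Num.max (f x - M) 0; pose W x := Num.max (u x - M) 0.
have mW : measurable_fun setT W.
  apply: measurable_maxr => //; apply: measurable_funB => //; exact: L2_measurable.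
have Wh_int : mu.-integrable setT (EFin \o (fun x => W x * h x)).
  apply: (@integrable_EFin_le _ _ _ mu _
    (fun x => (u x ^+ 2 + h x ^+ 2))).
  - by apply: measurable_funM => //; exact: L2_measurable.
  - move=> x; rewrite normrM.
    have : `|W x| <= `|u x|.
      rewrite /W ger0_norm ?le_max ?lexx ?orbT// ge_max normr_ge0 andbT.
      by have := ler_norm (u x); lra.
    move=> /(ler_wpM2r (normr_ge0 (h x))) /le_trans; apply.
    rewrite -(real_normK (num_real (u x))) -(real_normK (num_real (h x))).
    by have := sqr_ge0 (`|u x| - `|h x|); have := normr_ge0 (u x);
      have := normr_ge0 (h x); nra.
  - by apply: integrable_EFinD; exact: L2_integrable_sqr.
set C := `|f1 0| + L2norm mu h.
have I0 : I01 0 by apply/I01P; rewrite lexx ler01.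
have C0 : 0 <= C by rewrite addr_ge0// L2norm_ge0.
have f1C c : I01 c -> `|f1 c| <= C.
  move=> Ic; have := f1_var' I0 Ic; rewrite /C.
  by have := lerB_dist (f1 c) (f1 0); lra.
have w_lip x z : 0 <= x -> x <= z -> z <= 1 -> `|w z - w x| <= C * (z - x).
  move=> x0; rewrite le_eqVlt => /predU1P[->|xz z1]; first by rewrite !subrr normr0 mulr0.
  have [c /andP[xc cz] E] := derivative01_MVT ff1 x0 xz z1.
  have Ic : I01 c by apply/I01P; apply/andP; split; lra.
  have : `|f z - f x| <= C * (z - x).
    by rewrite E normrM (ger0_norm (_ : 0 <= z - x)) ?ler_wpM2r ?f1C//; lra.
  rewrite /w /Num.max; case: ifPn; case: ifPn; rewrite -?leNgt !ler_norml; lra.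
have w_mono p q : f p <= f q -> w p <= w q.
  by move=> pq; rewrite /w ge_max !le_max lexx orbT andbT lerD2r pq.
pose G x := \int[mu]_(z in `[0, x]) (W z * h z) - w x * f1 x.
have G01 : G 1 <= G 0.
  apply: (@increments_le0 G V (2 * C)) => x y x0 xy y1.
  have Ix : I01 x by apply/I01P; apply/andP; split; lra.
  have Iy : I01 y by apply/I01P; apply/andP; split; lra.
  have mxy : measurable `]x, y] by exact: measurable_itv.
  have h_intxy : mu.-integrable `]x, y] (EFin \o h).
    by apply: integrableS (L2_integrable h).
  have Vxy : V y - V x = \int[mu]_(z in `]x, y]) `|h z|.
    by rewrite /V Rintegral_itv_split// ltW.
  have -> : G y - G x =
      (\int[mu]_(z in `]x, y]) (W z * h z) - w x * (f1 y - f1 x)) -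
      (w y - w x) * f1 y.
    rewrite -(@Rintegral_itv_split (fun z => W z * h z))//; last exact: ltW.
    by rewrite /G; lra.
  have f1xy : f1 y - f1 x = \int[mu]_(z in `]x, y]) h z.
    have [_ _ E] := fD2; rewrite (E y Iy) (E x Ix) opprD addrACA subrr add0r.
    by rewrite Rintegral_itv_split//; [exact: L2_integrable|exact: ltW].
  have first_term : \int[mu]_(z in `]x, y]) (W z * h z) - w x * (f1 y - f1 x)
      <= C * (y - x) * (V y - V x).
    rewrite f1xy -RintegralZl// -RintegralB//.
    - rewrite Vxy -RintegralZl//; last by apply: integrableS abs_h_int.
      apply: le_Rintegral_ae => //.
      + apply: integrableS (integrable_EFinB Wh_int
          (integrable_EFinZ (w x) (L2_integrable h))) => //.
      + exact: integrableS (integrable_EFinZ (C * (y - x)) abs_h_int).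
      apply: ae_filterS1 uf => z /(_ I) uz /=; rewrite in_itv /= => /andP[xz zy].
      have -> : W z = w z by rewrite /W /w uz.
      rewrite -mulrBl; apply: le_trans (ler_norm _) _; rewrite normrM.
      apply: ler_wpM2r => //; apply: le_trans (w_lip x z x0 (ltW xz) _) _; first by lra.
      by apply: ler_wpM2l => //; lra.
    - by apply: integrableS Wh_int.
    - exact: integrableS (integrable_EFinZ (w x) (L2_integrable h)).
  (* With c between x and y such that f y - f x = f1 c * (y - x), the
     increment of w has the sign of f1 c, and f1 y is close to f1 c. *)
  have second_term : - ((w y - w x) * f1 y) <= C * (y - x) * (V y - V x).
    have [c /andP[xc cy] E] := derivative01_MVT ff1 x0 xy y1.
    have c0 : 0 <= c by exact: ltW (le_lt_trans x0 xc).
    have sgn : 0 <= (w y - w x) * f1 c.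
      have [c_ge0|/ltW c_le0] := leP 0 (f1 c).
        by rewrite mulr_ge0// subr_ge0 w_mono// -subr_ge0 E mulr_ge0// subr_ge0 ltW.
      rewrite mulr_le0// subr_le0 w_mono// -subr_le0 E mulr_le0_ge0//.
      by rewrite subr_ge0 ltW.
    have f1yc : `|f1 y - f1 c| <= V y - V x.
      by apply: le_trans (f1_var c0 (ltW cy) y1) _; rewrite lerD2l lerN2 V_mono// ltW.
    have -> : - ((w y - w x) * f1 y) =
        - ((w y - w x) * f1 c) - (w y - w x) * (f1 y - f1 c) by ring.
    apply: (@le_trans _ _ `|(w y - w x) * (f1 y - f1 c)|).
      by rewrite -lerBrDl opprK (le_trans (ler_norm _))// ?normrN ?lerDl.
    by rewrite normrM; apply: ler_pM => //; exact: w_lip (ltW xy) y1.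
  lra.
(* the boundary terms *)
have bd x : (x = 0) \/ (x = 1) -> w x * f1 x = 0.
  move=> x01; case: b bc => -[bc0 bc1].
    by case: x01 => ->; rewrite ?bc0 ?bc1 mulr0.
  suff -> : w x = 0 by rewrite mul0r.
  by rewrite /w; case: x01 => ->; rewrite ?bc0 ?bc1 sub0r; apply/max_idPr; lra.
move: G01; rewrite /G Rintegral_at0 bd; last by right.
rewrite (bd 0); last by left.
rewrite !subr0 Rintegral_I01//.
by case/integrableP : Wh_int => /measurable_EFinP.
Qed.

End D2_theory.

End mu_derivative.

(** * The maximum principle along orbits *)

Section maximum_principle.
Context {R : realType} {mu : probability (measurableTypeR R) R}.
Implicit Types (u v h : LspaceType2 mu).

(** Squared distance in L^2 to the convex set of functions at most M. *)
Definition excess (M : R) (u : LspaceType2 mu) : R :=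
  \int[mu]_x (Num.max (u x - M) 0 ^+ 2).

(** First-order expansion of the squared positive part of a - M in the
    direction k + r, where Young's inequality with parameter e bounds the
    contribution of the error r. *)
Lemma positive_part_sqr_le (a k r s e M : R) : 0 <= M -> 0 <= s -> 0 < e ->
  Num.max (a + s * (k + r) - M) 0 ^+ 2 <=
  Num.max (a - M) 0 ^+ 2 + 2 * s * (Num.max (a - M) 0 * k) +
  s * e * a ^+ 2 + s / e * r ^+ 2 + 2 * s ^+ 2 * k ^+ 2 + 2 * s ^+ 2 * r ^+ 2.
Proof.
move=> M0 s0 e0; set w := Num.max (a - M) 0.
have w0 : 0 <= w by rewrite le_max lexx orbT.
have aw : a - M <= w by rewrite le_max lexx.
have wa : w ^+ 2 <= a ^+ 2.
  by rewrite /w /Num.max; case: ifPn => [_|]; rewrite -?leNgt => *; nra.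
have h1 : Num.max (a + s * (k + r) - M) 0 ^+ 2 <= (w + s * (k + r)) ^+ 2.
  rewrite /Num.max; case: ifPn => [_|]; first by rewrite expr0n /= sqr_ge0.
  by rewrite -leNgt => ?; rewrite lerXn2r ?nnegrE; lra.
apply: le_trans h1 _.
have h2 : 2 * (w * r) <= e * w ^+ 2 + e^-1 * r ^+ 2.
  rewrite -subr_ge0.
  have -> : e * w ^+ 2 + e^-1 * r ^+ 2 - 2 * (w * r) = e * (w - r / e) ^+ 2.
    by field; rewrite gt_eqF.
  by rewrite mulr_ge0 ?sqr_ge0// ltW.
have h3 : s * (2 * (w * r)) <= s * (e * a ^+ 2 + e^-1 * r ^+ 2).
  apply: ler_wpM2l => //; apply: le_trans h2 _; rewrite lerD2r.
  by apply: ler_wpM2l => //; exact: ltW.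
have h4 : s ^+ 2 * (k + r) ^+ 2 <= s ^+ 2 * (2 * k ^+ 2 + 2 * r ^+ 2).
  by apply: ler_wpM2l; [exact: sqr_ge0|have := sqr_ge0 (k - r); nra].
have -> : (w + s * (k + r)) ^+ 2 = w ^+ 2 + 2 * s * (w * k) + s * (2 * (w * r))
   + s ^+ 2 * (k + r) ^+ 2 by ring.
by move: h3 h4; lra.
Qed.

Lemma positive_part_integrable u (M : R) : 0 <= M ->
  mu.-integrable setT (EFin \o (fun x => Num.max (u x - M) 0 ^+ 2)).
Proof.
move=> M0; apply: (@integrable_EFin_le _ _ _ mu _ (fun x => u x ^+ 2)).
- apply: measurable_funX; apply: measurable_maxr => //.
  by apply: measurable_funB => //; exact: L2_measurable.
- move=> x; rewrite ger0_norm ?sqr_ge0//.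
  by rewrite /Num.max; case: ifPn => [_|]; rewrite -?leNgt => *; nra.
- exact: L2_integrable_sqr.
Qed.

Lemma positive_partM_integrable u v (M : R) : 0 <= M ->
  mu.-integrable setT (EFin \o (fun x => Num.max (u x - M) 0 * v x)).
Proof.
move=> M0; apply: (@integrable_EFin_le _ _ _ mu _ (fun x => u x ^+ 2 + v x ^+ 2)).
- apply: measurable_funM; last exact: L2_measurable.
  apply: measurable_maxr => //.
  by apply: measurable_funB => //; exact: L2_measurable.
- move=> x; set w := Num.max _ _.
  have : w ^+ 2 <= u x ^+ 2.
    by rewrite /w /Num.max; case: ifPn => [_|]; rewrite -?leNgt => *; nra.
  rewrite ler_norml; have := sqr_ge0 (w - v x); have := sqr_ge0 (w + v x); nra.
- by apply: integrable_EFinD; exact: L2_integrable_sqr.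
Qed.

(** If v is close to u + s k and k pairs nonpositively with the positive part
    of u - M, then the excess grows by o(s) from u to v. *)
Lemma excess_step u v k (s e M : R) : 0 <= M -> 0 < s -> 0 < e ->
  L2norm mu (s^-1 *: (v - u) - k) <= e ->
  \int[mu]_x (Num.max (u x - M) 0 * k x) <= 0 ->
  excess M v <= excess M u + s * e * (L2norm mu u ^+ 2 + 1) +
    2 * s ^+ 2 * (L2norm mu k ^+ 2 + e ^+ 2).
Proof.
move=> M0 s0 e0; set r := _ - k => re diss.
have vE : v = u + s *: (k + r).
  by rewrite /r [k + _]addrC subrK scalerA divff ?gt_eqF// scale1r [RHS]addrC subrK.
have vE' : {ae mu, forall x, v x = u x + s * (k x + r x)}.
  move: r vE {re} => r vE; subst v.
  have e1 := @L2_addE _ _ _ mu u (s *: (k + r)).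
  have e2 := @L2_scaleE _ _ _ mu s (k + r).
  have e3 := @L2_addE _ _ _ mu k r.
  move: e1 e2 e3; apply: ae_filterS3 => x /(_ I) e1 /(_ I) e2 /(_ I) e3.
  by rewrite [LHS]e1 [X in _ + X]e2 [X in _ * X]e3.
have i1 := positive_part_integrable u M0.
have i2 := integrable_EFinZ (2 * s) (positive_partM_integrable u k M0).
have i3 := integrable_EFinZ (s * e) (L2_integrable_sqr u).
have i4 := integrable_EFinZ (s / e) (L2_integrable_sqr r).
have i5 := integrable_EFinZ (2 * s ^+ 2) (L2_integrable_sqr k).
have i6 := integrable_EFinZ (2 * s ^+ 2) (L2_integrable_sqr r).
have i12 := integrable_EFinD i1 i2.
have i13 := integrable_EFinD i12 i3.
have i14 := integrable_EFinD i13 i4.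
have i15 := integrable_EFinD i14 i5.
have i16 := integrable_EFinD i15 i6.
have : excess M v <= excess M u + 2 * s * \int[mu]_x (Num.max (u x - M) 0 * k x) +
    s * e * L2norm mu u ^+ 2 + s / e * L2norm mu r ^+ 2 +
    2 * s ^+ 2 * L2norm mu k ^+ 2 + 2 * s ^+ 2 * L2norm mu r ^+ 2.
  rewrite !L2norm_sqr /excess.
  rewrite -(RintegralZl _ measurableT (positive_partM_integrable u k M0)).
  rewrite -!(RintegralZl _ measurableT (L2_integrable_sqr _)) -!RintegralD//.
  apply: le_Rintegral_ae => //; first exact: positive_part_integrable.
  apply: ae_filterS1 vE' => x -> _; apply: positive_part_sqr_le => //; exact: ltW.
have re2 : L2norm mu r ^+ 2 <= e ^+ 2.
  by rewrite lerXn2r ?nnegrE ?L2norm_ge0// ltW.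
have sr : s / e * L2norm mu r ^+ 2 <= s * e.
  apply: (@le_trans _ _ (s / e * e ^+ 2)).
    by apply: ler_wpM2l => //; rewrite divr_ge0 ?ltW.
  by rewrite expr2 mulrA divfK ?gt_eqF.
have sd : 2 * s * \int[mu]_x (Num.max (u x - M) 0 * k x) <= 0.
  by apply: mulr_ge0_le0 => //; rewrite mulr_ge0// ltW.
have s2r : 2 * s ^+ 2 * L2norm mu r ^+ 2 <= 2 * s ^+ 2 * e ^+ 2.
  by apply: ler_wpM2l => //; rewrite mulr_ge0// sqr_ge0.
by move: sr sd s2r; rewrite !mulrDr mulr1; clear; lra.
Qed.

Lemma excess_le0_ae u (M : R) : 0 <= M -> excess M u <= 0 ->
  {ae mu, forall x, u x <= M}.
Proof.
move=> M0 ex0; have int := positive_part_integrable u M0.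
have ex : (\int[mu]_x `|(EFin \o (fun x => Num.max (u x - M) 0 ^+ 2)%R) x| = 0)%E.
  transitivity (excess M u)%:E.
    rewrite /excess /Rintegral fineK; last exact: integrable_fin_num.
    by apply: eq_integral => x _ /=; rewrite ger0_norm// sqr_ge0.
  congr EFin; apply/eqP; rewrite eq_le ex0 /=.
  by apply: Rintegral_ge0 => x _; exact: sqr_ge0.
case/integrableP : int => mw _.
have := (ae_eq_integral_abs mu measurableT mw).1 ex.
apply: ae_filterS1 => x /(_ I) /= [].
rewrite /Num.max; case: ifPn => [|_ /eqP]; first by rewrite subr_lt0 => /ltW.
by rewrite sqrf_eq0 subr_eq0 => /eqP ->.
Qed.

Context (mu01 : mu (`[0, 1]%classic : set R) = 1%E) (mu_atomless : atomless mu)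
  {b : boundary} {T : R -> LspaceType2 mu -> LspaceType2 mu}
  (TP : C0_contraction_semigroup setT (L2norm mu) T)
  (TG : generator setT (L2norm mu) T = krein_feller mu b).

(** Upper bounds are preserved along the orbits in the domain of the generator:
    over a time step s the excess grows by o(s) uniformly along the orbit, so
    that it remains 0. *)
Lemma orbit_ae_le u h t (M : R) : 0 <= t -> 0 <= M ->
  generator setT (L2norm mu) T (u, h) ->
  {ae mu, forall x, u x <= M} -> {ae mu, forall x, T t u x <= M}.
Proof.
move=> t0 M0 G uM; apply: excess_le0_ae => //.
have nP := @L2norm_on _ _ _ mu.
case: (TP) => _ _ [TP0 _] _ _.
have ex_u : excess M u = 0.
  rewrite /excess (@Rintegral_ae_eq _ _ _ mu _ (cst 0))//.
  - by rewrite Rintegral_cstT.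
  - by case/integrableP : (positive_part_integrable u M0) => /measurable_EFinP.
  - apply: ae_filterS1 uM => x uxM _.
    by rewrite (max_idPr _) ?subr_le0// expr0n.
move: t0; rewrite le_eqVlt => /predU1P[<-|t0]; first by rewrite TP0// ex_u.
set B := L2norm mu u ^+ 2; set H := L2norm mu h ^+ 2.
have B0 : 0 <= B by exact: sqr_ge0.
have H0 : 0 <= H by exact: sqr_ge0.
suff main (e : R) : 0 < e -> excess M (T t u) <= t * e * (B + 2).
  apply/ler_addgt0Pr => e e0; rewrite add0r.
  have c0 : 0 < t * (B + 2) by rewrite mulr_gt0// ltr_wpDl.
  apply: le_trans (main (e / (t * (B + 2))) _) _; first by rewrite divr_gt0.
  by rewrite mulrAC mulrC divfK ?gt_eqF.
move=> e0; have [/= _ _ gen] := G; move/cvg_right0P : gen => gen.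
have [|d d0 Hd] := gen _ e e0; first by move=> s; exact: L2norm_ge0.
(* the time step s = t / (n + 1) is taken so small that the second order
   terms contribute at most t e *)
set K := 2 * (H + e ^+ 2) + 1.
have K0 : 0 < K by rewrite ltr_wpDl// mulr_ge0// addr_ge0// sqr_ge0.
set m := Num.min d (e / K); have m0 : 0 < m by rewrite lt_min d0 divr_gt0.
have := truncnS_gt (t / m); set n := Num.truncn _ => nm.
have n0 : 0 < n.+1%:R :> R by [].
set s := t / n.+1%:R; have s0 : 0 < s by rewrite divr_gt0.
have sm : s < m by rewrite ltr_pdivrMr// mulrC -ltr_pdivrMr.
move: (sm); rewrite lt_min => /andP[sd seK].
set Q := s * e * (B + 1) + 2 * s ^+ 2 * (H + e ^+ 2).
have step k : excess M (T (k%:R * s) u) <= k%:R * Q.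
  elim: k => [|k IH]; first by rewrite !mul0r TP0// ex_u.
  have ks0 : 0 <= k%:R * s by rewrite mulr_ge0// ltW.
  have Gk := generator_orbit nP TP ks0 G.
  have -> : T (k.+1%:R * s) u = T s (T (k%:R * s) u).
    have -> : k.+1%:R * s = s + k%:R * s by rewrite -natr1 mulrDl mul1r addrC.
    exact: (semigroupD TP _ (ltW s0) ks0).
  rewrite -natr1 mulrDl mul1r; apply: le_trans (lerD IH (lexx Q)).
  have dissk : \int[mu]_x (Num.max (T (k%:R * s) u x - M) 0 * T (k%:R * s) h x) <= 0.
    move: Gk; rewrite TG => -[f [f1 [/= uf fD bc]]].
    exact: (D2_dissipative mu01 mu_atomless fD uf bc M0).
  have quot := difference_quotient_orbit TP u h ks0 (ltW s0).
  have {}quot := le_trans quot (ltW (Hd s _)); rewrite s0 sd in quot.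
  have := excess_step M0 s0 e0 (quot isT) dissk.
  move=> /le_trans; apply; rewrite -addrA lerD2l /Q.
  have hu : L2norm mu (T (k%:R * s) u) ^+ 2 <= B.
    by rewrite /B lerXn2r ?nnegrE ?L2norm_ge0//; exact: (semigroup_le TP).
  have hh : L2norm mu (T (k%:R * s) h) ^+ 2 <= H.
    by rewrite /H lerXn2r ?nnegrE ?L2norm_ge0//; exact: (semigroup_le TP).
  apply: lerD; first by rewrite ler_wpM2l ?lerD2r// mulr_ge0// ltW.
  by rewrite ler_wpM2l ?lerD2r// mulr_ge0// sqr_ge0.
have := step n.+1; rewrite /s mulrC divfK ?gt_eqF// => /le_trans; apply.
rewrite /Q -/s.
have ns : n.+1%:R * s = t by rewrite /s mulrC divfK ?gt_eqF.
have -> : n.+1%:R * (s * e * (B + 1) + 2 * s ^+ 2 * (H + e ^+ 2)) =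
    n.+1%:R * s * (e * (B + 1) + s * (2 * (H + e ^+ 2))) by ring.
rewrite ns -mulrA; apply: ler_wpM2l; first exact: ltW.
have sK : s * K <= e by rewrite -ler_pdivlMr// ltW.
have : s * (2 * (H + e ^+ 2)) <= s * K.
  by apply: ler_wpM2l; [exact: ltW|rewrite /K; lra].
lra.
Qed.

Context (supp0 : msupport mu 0) (supp1 : msupport mu 1).

Lemma generator_Cmu u h : generator setT (L2norm mu) T (u, h) -> Cmu mu b u.
Proof.
rewrite TG => -[f [f1 [/= uf fD bc]]]; exists f; split => //.
  exact: D2_continuous fD.
by case: b bc.
Qed.

Lemma generator_Cmu_norm_le u h : generator setT (L2norm mu) T (u, h) ->
  Cmu_norm mu b u <= 1 * (L2norm mu u + L2norm mu h).
Proof.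
rewrite TG mul1r => -[f [f1 [/= uf fD bc]]].
have urep : continuous_representative b u f.
  by split => //; [exact: D2_continuous fD|case: b bc].
apply: (Cmu_norm_le mu01 supp0 urep) => x sx.
exact: (D2_sup_le mu01 fD uf bc (msupport_sub01 mu01 sx)).
Qed.

Lemma orbit_Cmu_norm_le u h t : 0 <= t -> generator setT (L2norm mu) T (u, h) ->
  Cmu_norm mu b (T t u) <= Cmu_norm mu b u.
Proof.
move=> t0 G; have nP := @L2norm_on _ _ _ mu.
have [f uf] := generator_Cmu G.
have [g ug] := generator_Cmu (generator_orbit nP TP t0 G).
have [uf' fc _] := uf; have [ug' gc _] := ug.
have fM x := Cmu_norm_ub mu01 uf (x := x).
set M := Cmu_norm mu b u; have M0 : 0 <= M := le_trans (normr_ge0 _) (fM _ supp0).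
have uM : {ae mu, forall x, `|u x| <= M}.
  by apply: ae_filterS2 uf' (ae_msupport (mu := mu)) => x /(_ I) -> sx; exact: fM.
have GN : generator setT (L2norm mu) T (- u, - h).
  by have := generatorB nP TP (generatorB nP TP G G) G; rewrite !subrr !sub0r.
have up : {ae mu, forall x, T t u x <= M}.
  apply: (orbit_ae_le t0 M0 G); apply: ae_filterS1 uM => x.
  by rewrite ler_norml => /andP[].
have low : {ae mu, forall x, T t (- u) x <= M}.
  apply: (orbit_ae_le t0 M0 GN).
  apply: ae_filterS2 uM (@L2_oppE _ _ _ mu u) => x + /(_ I) ux.
  by rewrite [X in _ -> X <= _]ux ler_norml => /andP[]; lra.
have TN : T t (- u) = - T t u.
  by rewrite -[- u]scaleN1r (semigroupZ TP)// scaleN1r.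
apply: (Cmu_norm_le mu01 supp0 ug) => x sx; rewrite ler_norml; apply/andP; split.
- have gcN : {within `[0, 1]%classic, continuous (fun x => - g x)}.
    by move=> y; exact: cvgN (gc y).
  have := ae_le_msupport mu01 gcN (M := M) _ sx; rewrite lerNl; apply.
  rewrite TN in low.
  apply: ae_filterS3 ug' low (@L2_oppE _ _ _ mu (T t u)) => y /(_ I) <- + /(_ I) uy.
  by rewrite [X in X <= _ -> _]uy.
- apply: (ae_le_msupport mu01 gc _ sx).
  by apply: ae_filterS2 ug' up => y /(_ I) ->.
Qed.

End maximum_principle.

(** * Potentials of bounded densities *)

Section potentials.
Context {R : realType} {mu : probability (measurableTypeR R) R}.
Implicit Types (u h : LspaceType2 mu) (f g : R -> R).

Local Notation I01 := (`[0, 1]%classic : set R).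

Lemma D2_lin (a : R) f f1 h g g1 (k : LspaceType2 mu) : D2 f f1 h -> D2 g g1 k ->
  D2 (fun x => a * f x + g x) (fun x => a * f1 x + g1 x) (a *: h + k).
Proof.
move=> [/derivative01P ff1 f1c fE] [/derivative01P gg1 g1c gE]; split.
- apply/derivative01P => x Ix e e0.
  have a0 : 0 < `|a| + 1 by rewrite ltr_wpDl.
  have [|d d0 H] := ff1 x Ix (e / 2 / (`|a| + 1)); first by rewrite !divr_gt0.
  have [|d' d'0 H'] := gg1 x Ix (e / 2); first by rewrite divr_gt0.
  exists (Num.min d d'); first by rewrite lt_min d0.
  move=> y Iy; rewrite lt_min => /andP[yd yd'].
  have := H y Iy yd; have := H' y Iy yd'.
  set A := _ - f1 x * _; set B := _ - g1 x * _ => hB hA.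
  have -> : a * f y + g y - (a * f x + g x) - (a * f1 x + g1 x) * (y - x) = a * A + B.
    by rewrite /A /B; ring.
  apply: le_trans (ler_normD _ _) _; rewrite normrM.
  have : `|a| * `|A| <= e / 2 * `|y - x|.
    apply: (@le_trans _ _ ((`|a| + 1) * `|A|)); first by rewrite ler_wpM2r// lerDl.
    rewrite mulrC -ler_pdivlMr//; apply: le_trans hA _.
    by rewrite mulrAC.
  by move=> ?; lra.
- exact: within_continuous_lin.
- move=> x Ix; rewrite (fE x Ix) (gE x Ix).
  have mI : measurable (`[0, x] : set R) by exact: measurable_itv.
  have hi : mu.-integrable `[0, x] (EFin \o h) by exact: integrableS (L2_integrable h).
  have ki : mu.-integrable `[0, x] (EFin \o k) by exact: integrableS (L2_integrable k).
  rewrite mulrDr -!addrA; congr (_ + _); rewrite addrCA; congr (_ + _).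
  rewrite -RintegralZl// -RintegralD//; last first.
    by apply: integrableS (integrable_EFinZ a (L2_integrable h)).
  apply: Rintegral_ae_eq => //.
  + apply: measurable_funTS; apply: measurable_funD; last exact: L2_measurable.
    by apply: measurable_funM => //; exact: L2_measurable.
  + by apply: measurable_funTS; exact: L2_measurable.
  have e1 := @L2_addE _ _ _ mu (a *: h) k.
  have e2 := @L2_scaleE _ _ _ mu a h.
  by apply: ae_filterS2 e1 e2 => t /(_ I) e1 /(_ I) e2 _; rewrite [RHS]e1 [X in _ = X + _]e2.
Qed.

Lemma D2_affine (a c : R) : D2 (fun x => a * x + c) (fun=> a) (0 : LspaceType2 mu).
Proof.
split.
- apply/derivative01P => x Ix e e0; exists 1 => // y _ _.
  rewrite (_ : _ - _ = 0) ?normr0; last by ring.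
  by rewrite mulr_ge0// ltW.
- by move=> x; exact: cvg_cst.
- move=> x _; rewrite (@Rintegral_ae_eq _ _ _ mu _ (cst 0)) ?Rintegral_cst//.
  + by rewrite mul0r addr0.
  + by apply: measurable_funTS; exact: L2_measurable.
  + by apply: ae_filterS1 (@L2_zeroE _ _ _ mu) => t /(_ I).
Qed.

Lemma Rintegral_indic_bound g (K : R) (A : set R) : measurable_fun setT g ->
  measurable A -> (forall t, `|g t| <= K * \1_A t) ->
  `|\int[mu]_t g t| <= K * fine (mu A).
Proof.
move=> mg mA gK.
have iA : mu.-integrable setT (EFin \o (\1_A : R -> R)) by exact: integrable_indic.
have iK := integrable_EFinZ K iA.
have ig := @integrable_EFin_le _ _ _ mu g _ mg gK iK.
apply: le_trans (le_normr_Rintegral _ ig) _ => //.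
apply: (@le_trans _ _ (\int[mu]_t (K * \1_A t))).
  by apply: le_Rintegral => //; exact: integrable_abse ig.
by rewrite RintegralZl// /Rintegral integral_indic// setIT.
Qed.

Context (mu_atomless : atomless mu).

Lemma atomless_ball (x e : R) : 0 < e ->
  exists2 d : R, 0 < d & fine (mu (ball x d)) < e.
Proof.
move=> e0; pose F (n : nat) : set R := ball x n.+1%:R^-1.
have mF n : measurable (F n) by exact: measurable_ball.
have capF : \bigcap_n F n = [set x].
  apply/seteqP; split => [y Fy|_ -> n _]; last exact: ballxx.
  apply/eqP; rewrite eq_sym -subr_eq0 -normr_le0 leNgt; apply/negP => xy.
  have := truncnS_gt `|x - y|^-1; set n := Num.truncn _ => nxy.
  have := Fy n I; rewrite /F /ball /=; rewrite ltNge => /negP; apply.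
  by rewrite invf_ple ?posrE// ltW.
have /fine_cvgP[_ /cvgrPdist_lt/(_ e e0)[N _ HN]] : (mu \o F) n @[n --> \oo] --> 0%:E.
  rewrite -[0%:E](mu_atomless x) -capF; apply: nonincreasing_cvg_mu => //.
  - apply: (@le_lt_trans _ _ 1%E); last exact: ltry.
    by apply: probability_le1; exact: mF.
  - by rewrite capF; exact: measurable_set1.
  - move=> n m nm; apply/subsetPset; apply: le_ball.
    by rewrite lef_pV2 ?posrE// ler_nat.
exists N.+1%:R^-1 => //.
have := HN N (leqnn N); rewrite /= sub0r normrN ger0_norm//.
by apply: fine_ge0; exact: measure_ge0.
Qed.

Lemma step_increment (x y t d : R) : `|y - x| < d ->
  `|(t <= y)%R%:R - (t <= x)%R%:R| <= (`|x - t| < d)%R%:R :> R.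
Proof.
move=> yx.
have near_x : `|x - t| <= `|y - x| -> (`|x - t| < d) = true.
  by move=> ?; exact: le_lt_trans yx.
case: (leP t y) => ty; case: (leP t x) => tx /=; rewrite ?subrr ?normr0 ?ler0n//.
- by rewrite subr0 normr1 near_x// ler0_norm ?ger0_norm; lra.
- by rewrite sub0r normrN1 near_x// ger0_norm ?ler0_norm; lra.
Qed.

Lemma ramp_increment (x y t d : R) : `|y - x| < d ->
  `|Num.max (y - t) 0 - Num.max (x - t) 0 - (y - x) * (t <= x)%R%:R|
  <= `|y - x| * (`|x - t| < d)%R%:R.
Proof.
move=> yx.
have near_x : `|x - t| <= `|y - x| -> (`|x - t| < d) = true.
  by move=> ?; exact: le_lt_trans yx.
case: (leP t y) => ty; case: (leP t x) => tx /=.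
- rewrite !(max_idPl _) ?subr_ge0// mulr1 (_ : _ - _ = 0) ?normr0; last by ring.
  by rewrite mulr_ge0.
- rewrite (max_idPl _) ?subr_ge0// (max_idPr _) ?subr_le0 ?(ltW tx)// mulr0 !subr0.
  rewrite near_x ?mulr1; last by rewrite ler0_norm ?ger0_norm; lra.
  by rewrite !ger0_norm; lra.
- rewrite (max_idPr _) ?subr_le0 ?(ltW ty)// (max_idPl _) ?subr_ge0// mulr1.
  rewrite near_x ?mulr1; last by rewrite ger0_norm ?ler0_norm; lra.
  by rewrite (_ : _ - _ = t - y); [rewrite ger0_norm ?ler0_norm; lra|ring].
- rewrite !(max_idPr _) ?subr_le0 ?(ltW ty) ?(ltW tx)// mulr0 !subrr normr0.
  by rewrite mulr_ge0.
Qed.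

(** For a bounded density r that vanishes outside [0, 1] and a measure without
    atoms, the potential is the solution g of the Cauchy problem
    g(0) = g'(0) = 0 for which r is the mu-derivative of g'. *)
Definition potential (r : R -> R) (x : R) : R := \int[mu]_t (Num.max (x - t) 0 * r t).

Section potential_theory.
Context {r : R -> R} {c : R}.
Hypotheses (mr : measurable_fun [set: measurableTypeR R] r) (rc : forall t, `|r t| <= c)
  (r01 : forall t, ~ I01 t -> r t = 0).

Let r1 (x : R) := \int[mu]_(t in `[0, x]) r t.

Let step_fun (x t : R) : R := (t <= x)%R%:R.

Let m_step x : measurable_fun [set: measurableTypeR R] (step_fun x).
Proof.
rewrite (_ : step_fun x = \1_`]-oo, x]%classic).
  by apply: measurable_indic; exact: measurable_itv.
apply/funext => t; rewrite indicE /step_fun; congr (_%:R).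
by rewrite mem_setE in_itv.
Qed.

Let r_int : mu.-integrable setT (EFin \o r).
Proof.
apply: (@integrable_EFin_le _ _ _ mu _ (cst c)) => //.
exact: finite_measure_integrable_cst.
Qed.

Let step_int x : mu.-integrable setT (EFin \o (fun t => step_fun x t * r t)).
Proof.
apply: (@integrable_EFin_le _ _ _ mu _ (cst c)).
- exact: measurable_funM.
- move=> t; rewrite normrM /step_fun; case: (t <= x)%R => /=.
    by rewrite normr1 mul1r.
  by rewrite normr0 mul0r; exact: le_trans (normr_ge0 _) (rc t).
- exact: finite_measure_integrable_cst.
Qed.

Let m_ramp x : measurable_fun [set: measurableTypeR R] (fun t : R => Num.max (x - t) 0).
Proof. by apply: measurable_maxr => //; exact: measurable_funB. Qed.

Lemma potential_integrable x : I01 x ->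
  mu.-integrable setT (EFin \o (fun t => Num.max (x - t) 0 * r t)).
Proof.
move=> /I01P/andP[x0 x1]; apply: (@integrable_EFin_le _ _ _ mu _ (cst c)).
- exact: measurable_funM.
- move=> t; have [/I01P/andP[t0 t1]|nt] := pselect (I01 t); last first.
    by rewrite r01// mulr0 normr0; exact: le_trans (normr_ge0 _) (rc t).
  rewrite normrM -[leRHS]mul1r; apply: ler_pM => //.
  by rewrite ger0_norm ?le_max ?lexx ?orbT// ge_max; apply/andP; split; lra.
- exact: finite_measure_integrable_cst.
Qed.

Let r1E x : r1 x = \int[mu]_t (step_fun x t * r t).
Proof.
rewrite /r1 Rintegral_mkcond; apply: eq_Rintegral => t _.
rewrite patchE /step_fun mem_setE in_itv /=.
have [t0|t0] := leP 0 t; first by case: (t <= x)%R; rewrite ?mul1r ?mul0r.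
by rewrite r01 ?mulr0// => /I01P/andP[]; rewrite leNgt t0.
Qed.

Let c0 : 0 <= c.
Proof. exact: le_trans (normr_ge0 _) (rc 0). Qed.

(* Between x and y, the step and ramp functions only change on a small ball
   around x, whose mass is small because mu has no atoms. *)
Let ball_small x e : 0 < e -> exists2 d, 0 < d & c * fine (mu (ball x d)) <= e.
Proof.
move=> e0; have c10 : 0 < c + 1 by rewrite ltr_wpDl.
have [|d d0 Hd] := @atomless_ball x (e / (c + 1)); first by rewrite divr_gt0.
exists d => //; apply: (@le_trans _ _ ((c + 1) * fine (mu (ball x d)))).
  by apply: ler_wpM2r; [apply: fine_ge0; exact: measure_ge0|lra].
by rewrite mulrC -ler_pdivlMr// ltW.
Qed.

Let ballE (x d t : R) : (\1_(ball x d) t : R) = (`|x - t| < d)%R%:R.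
Proof. by rewrite indicE mem_setE. Qed.

Lemma D2_potential h : (h : R -> R) = r %[ae mu] -> D2 (potential r) r1 h.
Proof.
move=> hr; split.
- apply/derivative01P => x Ix e e0; have [d d0 Hd] := ball_small x e0.
  exists d => // y Iy yx.
  rewrite /potential r1E -[_ * (y - x)]mulrC -RintegralZl//.
  have iyx := integrable_EFinB (potential_integrable Iy) (potential_integrable Ix).
  have isx := integrable_EFinZ (y - x) (step_int x).
  rewrite -(RintegralB measurableT (potential_integrable Iy) (potential_integrable Ix)).
  rewrite -(RintegralB measurableT iyx isx).
  apply: (@le_trans _ _ (`|y - x| * c * fine (mu (ball x d)))); last first.
    by rewrite -mulrA [e * _]mulrC; apply: ler_wpM2l.
  apply: Rintegral_indic_bound; last first.
  + move=> t; rewrite mulrA -!mulrBl normrM ballE mulrAC.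
    by apply: ler_pM => //; exact: ramp_increment.
  + exact: measurable_ball.
  + apply: measurable_funB.
      by apply: measurable_funB; exact: (measurable_funM (m_ramp _) mr).
    by apply: measurable_funM => //; exact: (measurable_funM (m_step _) mr).
- apply/within_continuousP => x Ix e e0.
  have e20 : 0 < e / 2 by rewrite divr_gt0.
  have [d d0 Hd] := ball_small x e20; exists d => // y Iy yx.
  rewrite !r1E -RintegralB//.
  apply: (@le_lt_trans _ _ (c * fine (mu (ball x d)))); last by lra.
  apply: Rintegral_indic_bound; last first.
  + move=> t; rewrite -!mulrBl normrM ballE mulrC.
    by apply: ler_pM => //; exact: step_increment.
  + exact: measurable_ball.
  + by apply: measurable_funB; exact: (measurable_funM (m_step _) mr).
- move=> x _; rewrite {2}/r1 Rintegral_at0// add0r.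
  apply: Rintegral_ae_eq.
  + exact: measurable_itv.
  + exact: measurable_funTS.
  + by apply: measurable_funTS; exact: L2_measurable.
  + by apply: ae_filterS1 hr => t /(_ I) ->.
Qed.

End potential_theory.

End potentials.

(** * Density of the domain of the generator *)

Section density.
Context {R : realType} {mu : probability (measurableTypeR R) R}.
Implicit Types (u h : LspaceType2 mu) (f g p : R -> R)
  (b : boundary).

Local Notation I01 := (`[0, 1]%classic : set R).
Local Notation ramp z := (fun x : R => Num.max (x - z) 0).

Context (mu01 : mu I01 = 1%E) (mu_atomless : atomless mu)
  (supp0 : msupport mu 0) (supp1 : msupport mu 1).

Lemma ramp_lipschitz (x s t : R) :
  `|Num.max (x - t) 0 - Num.max (x - s) 0| <= `|s - t|.
Proof.
case: (leP t x) => tx; case: (leP s x) => sx.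
- rewrite !(max_idPl _) ?subr_ge0// (_ : _ - _ = s - t)//; by ring.
- rewrite (max_idPl _) ?subr_ge0// (max_idPr _) ?subr_le0 ?(ltW sx)// subr0.
  by rewrite !ger0_norm; lra.
- rewrite (max_idPr _) ?subr_le0 ?(ltW tx)// (max_idPl _) ?subr_ge0// sub0r.
  by rewrite normrN ger0_norm ?ler0_norm; lra.
- by rewrite !(max_idPr _) ?subr_le0 ?(ltW tx) ?(ltW sx)// subrr normr0.
Qed.

(** A ramp starting at a point of the support is a uniform limit of potentials
    of uniform densities concentrated near this point. *)
Lemma ramp_smoothing (z e : R) : msupport mu z -> 0 < e ->
  exists g g1 (h : LspaceType2 mu), [/\ D2 g g1 h, g1 0 = 0, g1 1 = 1
    & forall x, I01 x -> `|g x - ramp z x| <= e].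
Proof.
move=> sz e0; pose A : set R := ball z e `&` I01.
have mA : measurable A.
  by apply: measurableI; [exact: measurable_ball|exact: measurable_itv].
have A0 : 0 < fine (mu A).
  rewrite lt_neqAle fine_ge0 ?measure_ge0// andbT; apply/negP => /eqP A0.
  have nA : mu.-negligible A.
    apply/negligibleP => //; rewrite -[LHS]fineK -?A0//.
    exact: fin_num_measure.
  have := sz (ball z e) (ball_open _ _) (ballxx _ e0).
  suff /negligibleP -> : mu.-negligible (ball z e); first by rewrite ltxx.
    exact: measurable_ball.
  apply: (negligibleS _ (negligibleU nA (negligible_off01 mu01))) => y zy.
  by have [Iy|nIy] := pselect (I01 y); [left|right].
set c := (fine (mu A))^-1; have c0 : 0 < c by rewrite invr_gt0.
pose r t : R := c * \1_A t.
have mr : measurable_fun [set: measurableTypeR R] r.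
  by apply: measurable_funM => //; exact: measurable_indic.
have r0 t : 0 <= r t by rewrite mulr_ge0// ltW.
have rc t : `|r t| <= c.
  rewrite ger0_norm// /r indicE; case: (t \in A); rewrite ?mulr1// mulr0; exact: ltW.
have r01 t : ~ I01 t -> r t = 0.
  by move=> nt; rewrite /r indicE memNset ?mulr0// => -[].
have [h hr] : exists h : LspaceType2 mu, (h : R -> R) = r %[ae mu].
  exact: (@L2_of_bounded _ (measurableTypeR R) R mu r c mr rc).
have int1 : \int[mu]_t r t = 1.
  rewrite RintegralZl//; last by exact: integrable_indic.
  by rewrite /Rintegral integral_indic// setIT mulVf// gt_eqF.
have fD := D2_potential mu_atomless mr rc r01 hr.
exists (potential (mu := mu) r), (fun x => \int[mu]_(t in `[0, x]) r t), h; split => //.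
- by rewrite (Rintegral_at0 mu_atomless).
- by rewrite (Rintegral_I01 mu01).
move=> x Ix; rewrite /potential.
have r_int : mu.-integrable setT (EFin \o r).
  apply: (@integrable_EFin_le _ _ _ mu _ (cst c)) => //.
  exact: finite_measure_integrable_cst.
have -> : ramp z x = \int[mu]_t (ramp z x * r t) by rewrite RintegralZl// int1 mulr1.
rewrite -RintegralB//; last 2 first.
- apply: (potential_integrable mr rc r01 Ix).
- exact: integrable_EFinZ.
apply: le_trans (Rintegral_indic_bound (K := e * c) (A := A) _ mA _) _.
- apply: measurable_funB; last by apply: measurable_funM.
  apply: measurable_funM => //; apply: measurable_maxr => //.
  exact: measurable_funB.
- move=> t; rewrite -mulrBl normrM (ger0_norm (r0 t)) /r mulrA indicE.
  case: (boolP (t \in A)) => [|_]; last by rewrite !mulr0.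
  rewrite inE => -[zt _]; rewrite !mulr1; apply: ler_wpM2r; first exact: ltW.
  apply: le_trans (ltW zt); exact: ramp_lipschitz.
by rewrite -mulrA mulVf ?mulr1// gt_eqF.
Qed.

(** Uniform limits on [0, 1] of functions whose derivative has a mu-derivative
    and vanishes at 0. *)
Definition D2_approximable (p : R -> R) : Prop := forall e : R, 0 < e ->
  exists g g1 (h : LspaceType2 mu), [/\ D2 g g1 h, g1 0 = 0
    & forall x, I01 x -> `|g x - p x| <= e].

Lemma D2_approximable_cst (c : R) : D2_approximable (cst c).
Proof.
move=> e e0; exists (fun x => 0 * x + c), (fun=> 0), 0; split => //.
  exact: D2_affine.
by move=> x _; rewrite mul0r add0r subrr normr0 ltW.
Qed.

Lemma D2_approximable_ramp z : msupport mu z -> D2_approximable (ramp z).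
Proof.
by move=> sz e e0; have [g [g1 [h [H H0 _ H1]]]] := ramp_smoothing sz e0; exists g, g1, h.
Qed.

Lemma D2_approximable_lin (a : R) p q : D2_approximable p -> D2_approximable q ->
  D2_approximable (fun x => a * p x + q x).
Proof.
move=> Hp Hq e e0; have a0 : 0 < `|a| + 1 by rewrite ltr_wpDl.
have [|g [g1 [h [gD g10 gp]]]] := Hp (e / 2 / (`|a| + 1)); first by rewrite !divr_gt0.
have [|k [k1 [l [kD k10 kq]]]] := Hq (e / 2); first by rewrite divr_gt0.
exists (fun x => a * g x + k x), (fun x => a * g1 x + k1 x), (a *: h + l); split.
- exact: D2_lin.
- by rewrite g10 k10 mulr0 addr0.
move=> x Ix; rewrite (_ : _ - _ = a * (g x - p x) + (k x - q x)); last by ring.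
apply: le_trans (ler_normD _ _) _; rewrite normrM.
have : `|a| * `|g x - p x| <= e / 2.
  apply: (@le_trans _ _ ((`|a| + 1) * `|g x - p x|)); first by rewrite ler_wpM2r// lerDl.
  by rewrite mulrC -ler_pdivlMr//; exact: gp.
by have := kq x Ix; lra.
Qed.

(** [node f e z] holds when f is approximated up to e on the part of the
    support left of the point z of the support by a function that interpolates
    f at z and is affine to the right of z. *)
Definition node f (e : R) : set R := [set z | msupport mu z /\
  exists2 p, D2_approximable p & [/\ p z = f z,
    exists a : R, forall x, z <= x -> p x = p z + a * (x - z) &
    forall x, msupport mu x -> x <= z -> `|p x - f x| <= e]].

Lemma node_step f (e z z' : R) : 0 < e -> node f e z -> z < z' -> msupport mu z' ->
  (forall x, msupport mu x -> z < x < z' ->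
    `|f x - f z| <= e /\ `|f x - f z'| <= e) ->
  node f e z'.
Proof.
move=> e0 [sz [p Hp [pz [a pa] pf]]] zz' sz' H; split => //.
set s := (f z' - f z) / (z' - z).
have szz : s * (z' - z) = f z' - f z by rewrite /s divfK// subr_eq0 gt_eqF.
pose q x := (s - a) * Num.max (x - z) 0 + p x.
have ql x : x <= z -> q x = p x.
  by move=> xz; rewrite /q (max_idPr _) ?subr_le0// mulr0 add0r.
have qr x : z <= x -> q x = f z + s * (x - z).
  by move=> zx; rewrite /q (max_idPl _) ?subr_ge0// pa// pz; ring.
have qz' : q z' = f z' by rewrite qr ?ltW// szz; ring.
exists q.
  by apply: D2_approximable_lin => //; exact: D2_approximable_ramp.
split => //.
  exists s => x z'x; rewrite qz' qr ?(le_trans (ltW zz') z'x)//.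
  by rewrite -[f z'](subrK (f z)) -szz; ring.
move=> x sx; rewrite le_eqVlt => /predU1P[->|xz'].
  by rewrite qz' subrr normr0 ltW.
have [xz|zx] := leP x z; first by rewrite ql//; exact: pf.
have [h1 h2] := H x sx (introT andP (conj zx xz')).
rewrite qr ?(ltW zx)//.
(* q x is the convex combination of f z and f z' with weight th on f z' *)
set th := (x - z) / (z' - z).
have th0 : 0 <= th by rewrite divr_ge0//; lra.
have th1 : th <= 1 by rewrite ler_pdivrMr; lra.
have -> : f z + s * (x - z) - f x = (1 - th) * (f z - f x) + th * (f z' - f x).
  have -> : s * (x - z) = th * (f z' - f z).
    by rewrite /s /th mulrAC -mulrA mulrC.
  by ring.
clearbody th; apply: le_trans (ler_normD _ _) _; rewrite !normrM (ger0_norm th0).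
rewrite (ger0_norm (_ : 0 <= 1 - th)); last by lra.
rewrite (distrC (f z)) (distrC (f z')).
have : (1 - th) * `|f x - f z| <= (1 - th) * e by rewrite ler_wpM2l//; lra.
have : th * `|f x - f z'| <= th * e by rewrite ler_wpM2l.
lra.
Qed.

(** A closure point of the support is in the support. *)
Lemma msupport_limit (s : R) : (forall d : R, 0 < d ->
  exists2 z, msupport mu z & `|z - s| < d) -> msupport mu s.
Proof.
move=> H; apply: msupport_closed => B /nbhs_ballP[d /= d0 dB].
have [z sz zs] := H d d0; exists z; split => //; apply: dB.
by rewrite /ball /= distrC.
Qed.

(** The nodes form a set that contains 0 and has 1 as its greatest element:
    its supremum s is a node, and if s < 1, then a further node is found either
    close to s or across the gap of the support that starts at s. *)
Lemma node1 f (e : R) : {within I01, continuous f} -> 0 < e -> node f e 1.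
Proof.
move=> /within_continuousP fc e0.
have N0 : node f e 0.
  split=> //; exists (cst (f 0)); first exact: D2_approximable_cst.
  split => //; first by exists 0 => x _; rewrite mul0r addr0.
  move=> x sx x0; have /I01P/andP[x0' _] := msupport_sub01 mu01 sx.
  by rewrite (_ : x = 0) ?subrr ?normr0 ?ltW//; apply/eqP; rewrite eq_le x0.
have hs : has_sup (node f e).
  by split; [exists 0|exists 1 => z [/(msupport_sub01 mu01)/I01P/andP[]]].
set s := sup (node f e).
have nle z : node f e z -> z <= s by move=> nz; exact: (sup_upper_bound hs).
have near_s d : 0 < d -> exists2 z, node f e z & s - d < z <= s.
  move=> d0; have [z nz sz] := sup_adherent d0 hs; exists z => //.
  by rewrite sz nle.
have ss : msupport mu s.
  apply: msupport_limit => d d0; have [z nz /andP[sz zs]] := near_s d d0.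
  by exists z; [case: nz|rewrite ler0_norm; lra].
have Is := msupport_sub01 mu01 ss; have /I01P/andP[s0 s1] := Is.
have e20 : 0 < e / 2 by rewrite divr_gt0.
have [d d0 Hd] := fc s Is _ e20.
have close x : msupport mu x -> `|x - s| < d -> `|f x - f s| < e / 2.
  by move=> sx; exact: Hd (msupport_sub01 mu01 sx).
have ns : node f e s.
  have [z nz /andP[sz]] := near_s d d0.
  rewrite le_eqVlt => /predU1P[<-//|zs].
  apply: (node_step e0 nz zs ss) => x sx /andP[zx xs].
  have fx : `|f x - f s| < e / 2 by apply: close => //; rewrite ler0_norm; lra.
  have fz : `|f z - f s| < e / 2.
    by case: nz => sz' _; apply: close => //; rewrite ler0_norm; lra.
  by move: fx fz; rewrite !ltr_norml !ler_norml; lra.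
have [s1'|s1'] := leP 1 s; first by rewrite (_ : 1 = s)//; apply/eqP; rewrite eq_le s1' s1.
exfalso.
have [[z' [sz' sz'1 sz'2]]|gap] := pselect (exists z', [/\ msupport mu z', s < z'
    & z' < s + d]).
  have : node f e z'.
    apply: (node_step e0 ns sz'1 sz') => x sx /andP[zx xs].
    have fx : `|f x - f s| < e / 2 by apply: close => //; rewrite ger0_norm; lra.
    have fz : `|f z' - f s| < e / 2 by apply: close => //; rewrite ger0_norm; lra.
    by move: fx fz; rewrite !ltr_norml !ler_norml; lra.
  by move/nle; rewrite leNgt sz'1.
pose S' : set R := [set x | msupport mu x /\ s < x].
have S'd x : S' x -> s + d <= x.
  by move=> [sx sxs]; rewrite leNgt; apply/negP => xsd; apply: gap; exists x.
have hi : has_inf S' by split; [exists 1|exists (s + d) => x /S'd].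
have infd : s + d <= inf S' by apply: lb_le_inf; [exists 1|move=> x /S'd].
have si : msupport mu (inf S').
  apply: msupport_limit => k k0; have [z [sz zs] zk] := inf_adherent k0 hi.
  exists z => //; rewrite ger0_norm; first by lra.
  by rewrite subr_ge0; apply: (ge_inf hi.2).
have s_inf : s < inf S' by lra.
have : node f e (inf S').
  apply: (node_step e0 ns s_inf si) => x sx /andP[sx1 sx2].
  suff : inf S' <= x by rewrite leNgt sx2.
  exact: (ge_inf hi.2).
by move/nle; rewrite leNgt s_inf.
Qed.

(** The continuous extension given by Tietze's theorem is measurable and
    bounded on the line, hence defines a class. *)
Lemma continuous_class f : {within I01, continuous f} ->
  exists u : LspaceType2 mu, representative u f.
Proof.
move=> fc; have [M HM] := within_continuous_bounded fc.
have cI : closed I01 by exact: itv_closed.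
have M0 : 0 < `|M| + 1 by rewrite ltr_wpDl.
have HM' x : I01 x -> `|f x| <= `|M| + 1.
  by move=> Ix; have := HM x Ix; have := ler_norm M; lra.
have [h [fh hc hM]] : exists h : R -> R, [/\ {in I01, f =1 h},
    continuous h & forall x, `|h x| <= `|M| + 1].
  exact: continuous_bounded_extension pseudometric_normal _ cI _ _ M0 fc HM'.
have [u uh] : exists u : LspaceType2 mu, (u : R -> R) = h %[ae mu].
  apply: (@L2_of_bounded _ (measurableTypeR R) R mu h (`|M| + 1)) => //.
  exact: continuous_measurable_fun.
exists u; have I1 : {ae mu, forall x, I01 x} by exact: negligible_off01.
by apply: ae_filterS2 uh I1 => x /(_ I) -> Ix _; rewrite fh ?inE.
Qed.

Lemma krein_feller_dense b u (e : R) : Cmu mu b u -> 0 < e ->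
  exists v h, krein_feller mu b (v, h) /\ Cmu_norm mu b (u - v) < e.
Proof.
move=> [f uf] e0; have [uf' fc f01] := uf.
(* g is within 2 k of f on the support, and restoring the boundary condition
   costs at most 4 k more *)
set k := e / 8; have k0 : 0 < k by rewrite divr_gt0.
have [_ [p Hp [_ _ pf]]] := node1 fc k0.
have [g [g1 [h [gD g10 gp]]]] := Hp k k0.
have gf x : msupport mu x -> `|g x - f x| <= k + k.
  move=> sx; have Ix := msupport_sub01 mu01 sx.
  have x1 : x <= 1 by move/I01P/andP: Ix => [].
  by have := gp x Ix; have := pf x sx x1; have := ler_distD (p x) (g x) (f x); lra.
suff [w [w1 [l [wD wbc wf]]]] : exists w w1 (l : LspaceType2 mu),
    [/\ D2 w w1 l, boundary_condition b w w1
      & forall x, msupport mu x -> `|w x - g x| <= 4 * k].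
  have [v vw] := continuous_class (D2_continuous wD).
  exists v, l; split; first by exists w, w1.
  have vrep : continuous_representative b v w.
    by split => //; [exact: D2_continuous wD|case: (b) wbc].
  apply: (@le_lt_trans _ _ (6 * k)); last by rewrite /k; lra.
  apply: (Cmu_norm_le mu01 supp0 (continuous_representativeB uf vrep)) => x sx.
  have := wf x sx; have := gf x sx; have := ler_distD (g x) (f x) (w x).
  by rewrite [`|g x - f x|]distrC [`|g x - w x|]distrC; lra.
case: b f01 {uf} => [_|[f0 f1]].
- (* correct the slope at 1 by a multiple of a uniformly small function that
     has slope 1 at 1 *)
  have c0 : 0 < `|g1 1| + 1 by rewrite ltr_wpDl.
  have [|q [q1 [l [qD q10 q11 qr]]]] := ramp_smoothing (e := k / (`|g1 1| + 1)) supp1.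
    by rewrite divr_gt0.
  exists (fun x => - g1 1 * q x + g x), (fun x => - g1 1 * q1 x + g1 x), (- g1 1 *: l + h).
  split; first exact: D2_lin.
    by rewrite /= q10 q11 g10; split; ring.
  move=> x sx; have Ix := msupport_sub01 mu01 sx.
  rewrite addrK normrM normrN.
  have := qr x Ix; rewrite (max_idPr _) ?subr0; last first.
    by move/I01P/andP: Ix => [_]; rewrite subr_le0.
  rewrite ler_pdivlMr// => qk.
  have : `|g1 1| * `|q x| <= `|q x| * (`|g1 1| + 1).
    by rewrite mulrC ler_wpM2l// lerDl.
  lra.
- (* subtract the affine interpolation at the end points *)
  have g0k : `|g 0| <= k + k by have := gf 0 supp0; rewrite f0 subr0.
  have g1k : `|g 1| <= k + k by have := gf 1 supp1; rewrite f1 subr0.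
  exists (fun x => 1 * g x + ((g 0 - g 1) * x + - g 0)),
    (fun x => 1 * g1 x + (g 0 - g 1)), (1 *: h + 0).
  split; first by apply: D2_lin => //; exact: D2_affine.
    by rewrite /=; split; ring.
  move=> x sx; have /I01P/andP[x0 x1] := msupport_sub01 mu01 sx.
  rewrite mul1r addrC addKr.
  rewrite (_ : _ + _ = (1 - x) * - g 0 + x * - g 1); last by ring.
  apply: le_trans (ler_normD _ _) _; rewrite !normrM !normrN (ger0_norm x0).
  rewrite (ger0_norm (_ : 0 <= 1 - x)); last by lra.
  have : (1 - x) * `|g 0| <= 1 * (k + k) by apply: ler_pM => //; lra.
  have : x * `|g 1| <= 1 * (k + k) by apply: ler_pM => //; lra.
  lra.
Qed.

End density.

Theorem corollary4p5 (R : realType) (b : boundary)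
    (mu : probability (measurableTypeR R) R)
    (mu01 : mu (`[0, 1]%classic : set R) = 1%E)
    (mu_atomless : atomless mu)
    (supp0 : msupport mu 0) (supp1 : msupport mu 1)
    (T : R -> LspaceType2 mu -> LspaceType2 mu)
    (T_semigroup : C0_contraction_semigroup setT (L2norm mu) T)
    (T_generator : generator setT (L2norm mu) T = krein_feller mu b) :
  banach_subspace (Cmu mu b) (Cmu_norm mu b) /\
  C0_contraction_semigroup (Cmu mu b) (Cmu_norm mu b) T.
Proof.
have CB := Cmu_banach mu01 supp0 supp1 b; split => //.
apply: (restricted_semigroup (C := 1) (@L2norm_on _ _ _ mu) CB _ T_semigroup).
- by move=> u [f uf]; exact: (L2norm_le_Cmu_norm mu01 supp0 uf).
- by move=> u h; exact: generator_Cmu T_generator _ _.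
- by move=> u h; exact: (generator_Cmu_norm_le mu01 T_generator supp0).
- move=> u h t; exact: (orbit_Cmu_norm_le mu01 mu_atomless T_semigroup T_generator supp0).
- by move=> u e; rewrite T_generator; exact: (krein_feller_dense mu01 mu_atomless supp0 supp1).
Qed.
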